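(* Let $L$ be a compact metric space and let $K$ be a compact space. Then the following assertions are equivalent: \begin{enumerate} \item[(i)] $C(K)$ contains an isometric copy of $C(L)$; \item[(ii)] there exists a closed subset of $K$ which maps continuously onto $L$; \item[(iii)] $|L^{(\alpha)}|\le |K^{(\alpha)}|$ for each ordinal $\alpha$; \item[(iv)] if $L$ is nonscattered, then $K$ is nonscattered, and if $L$ is scattered, then $|L^{(ht(L)-1)}|\le |K^{(ht(L)-1)}|$; \item[(v)] $C(K)$ contains a positive isometric copy of $C(L)$; \item[(vi)] there is an isomorphic embedding $T\colon C(L)\to C(K)$ with $\|T\|\,\|T^{-1}\|<3$; \item[(vii)] for each Banach space $E$, $C(K,E)$ contains an isometric copy of $C(L)$; \item[(viii)] there exists a strictly convex Banach space $E$ such that $C(K,E)$ contains an isometric copy of $C(L)$. \end{enumerate}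
   Context: All compact spaces are Hausdorff. All Banach spaces are real and of dimension at least one, so the compact spaces considered here are nonempty. For a Banach space $E$, $C(K,E)$ is the Banach space of continuous $E$-valued functions on $K$ with the supremum norm, and $C(K)=C(K,\mathbb R)$, which is also a Banach lattice with pointwise order. Embeddings of Banach spaces are linear: an isomorphic embedding is a bounded linear operator that is an isomorphism onto its image, and $T^{-1}$ is the inverse defined on the image; an isometric embedding is a linear norm-preserving map. A space $F$ contains an isometric copy of $C(L)$ if there is an isometric embedding $C(L)\to F$; $C(K)$ contains a positive isometric copy of $C(L)$ if there is an isometric embedding $T\colon C(L)\to C(K)$ with $T(f)\ge 0$ whenever $f\ge0$. Cantor--Bendixson derivatives: for a topological space $S$, $S^{(0)}=S$, $S^{(1)}$ is the set of accumulation points of $S$, $S^{(\alpha)}=(S^{(\beta)})^{(1)}$ for $\alpha=\beta+1$, and $S^{(\alpha)}=\bigcap_{\beta<\alpha}S^{(\beta)}$ for limit $\alpha$. The perfect kernel $S^{(\infty)}$ is the eventual constant value of $S^{(\alpha)}$. $S$ is scattered if $S^{(\infty)}=\emptyset$, and then $ht(S)$ is the least ordinal $\alpha$ with $S^{(\alpha)}=\emptyset$ (for a nonempty scattered compact space it is a successor ordinal, and $ht(S)-1$ is its predecessor). *)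

(* Defs.v *)
From HB Require Import structures.
From mathcomp Require Import all_boot all_order all_algebra.
From mathcomp Require Import all_classical all_reals all_analysis.

Set Implicit Arguments.
Unset Strict Implicit.
Unset Printing Implicit Defensive.

Import Order.TTheory GRing.Theory Num.Theory.
Import numFieldNormedType.Exports.

Local Open Scope classical_set_scope.
Local Open Scope ring_scope.

(* Ordinals are represented by trees: [osup f] denotes the supremum of the
   family [f], which may be any small family, possibly empty or with a largest
   member.  Different trees may denote the same ordinal; equality of ordinals
   is [ole a b /\ ole b a].  Every well-ordered type is represented
   (lemma [orank_mono]), and everything below only depends on the ordinal
   denoted by a tree (lemma [cb_deriv_anti]). *)
Inductive Ord : Type :=
| ozero : Ord
| osucc : Ord -> Ord
| osup : forall J : Type, (J -> Ord) -> Ord.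

(* The inner fixpoint decides [a' < b], which is what [osucc a' <= b] means. *)
Fixpoint ole (a b : Ord) : Prop :=
  match a with
  | ozero => True
  | osucc a' =>
      (fix lt_a' (b : Ord) : Prop :=
        match b with
        | ozero => False
        | osucc b' => ole a' b'
        | osup J g => exists j : J, lt_a' (g j)
        end) b
  | osup J f => forall i : J, ole (f i) b
  end.

Definition olt (a b : Ord) : Prop := ole (osucc a) b.

Definition olimit (a : Ord) : Prop :=
  olt ozero a /\ forall b, olt b a -> olt (osucc b) a.

Lemma ole_sup_r (J : Type) (f : J -> Ord) (i : J) (a : Ord) :
  ole a (f i) -> ole a (osup f).
Proof. by elim: a => //= [a _|J' g IHg] H; [exists i|move=> j; exact: IHg]. Qed.

Lemma ole_refl (a : Ord) : ole a a.
Proof. by elim: a => //= J f IHf i; exact: ole_sup_r (IHf i). Qed.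

Lemma ole_trans (b a c : Ord) : ole a b -> ole b c -> ole a c.
Proof.
elim: a b c => [//|a IHa|J f IHf] b c; last first.
  by move=> /= ab bc i; exact: IHf (ab i) bc.
elim: b c => [//|b _|J' g IHg] c; last first.
  by move=> [j agj] /(_ j); exact: IHg.
move=> /= ab; elim: c => [//|c _ /= bc|J' g IHg /= [j bgj]].
  exact: IHa ab bc.
by exists j; exact: IHg.
Qed.

Lemma ole_osucc (a : Ord) : ole a (osucc a).
Proof.
elim: a => //= J f IHf i; apply: ole_trans (IHf i) _ => /=.
exact: ole_sup_r (ole_refl _).
Qed.

Lemma olt_le (a b : Ord) : olt a b -> ole a b.
Proof. exact: ole_trans (ole_osucc a). Qed.

Lemma ole_or_gt (a b : Ord) : ole a b \/ olt b a.
Proof.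
elim: a b => [|a IHa|J f IHf] b; first by left.
- elim: b => [|b _|J' g IHg]; first by right.
    exact: IHa.
  have [[j agj]|H] := pselect (exists j, ole (osucc a) (g j)).
    by left; exists j.
  by right => j; case: (IHg j) => // agj; case: H; exists j.
- have [[i bfi]|H] := pselect (exists i, olt b (f i)).
    by right; exists i.
  by left => i; case: (IHf i b) => // bfi; case: H; exists i.
Qed.

Lemma olt_wf : well_founded olt.
Proof.
suff H a b : olt b a -> Acc olt b.
  by move=> b; exact: H (ole_refl (osucc b)).
elim: a b => [//|a IHa|J f IHf] b.
  by move=> ba; constructor => c cb; apply: IHa; exact: ole_trans cb ba.
by move=> [i bfi]; exact: IHf bfi.
Qed.

Lemma olt_irr (a : Ord) : ~ olt a a.
Proof. by elim: a / (olt_wf a) => a _ IHa ha; exact: (IHa a ha ha). Qed.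

Definition orank (W : Type) (lt : W -> W -> Prop) (wf : well_founded lt) :
    W -> Ord :=
  Fix wf (fun=> Ord) (fun w rec =>
    osup (fun v : {v | lt v w} => osucc (rec (sval v) (svalP v)))).

Lemma orank_mono (W : Type) (lt : W -> W -> Prop) (wf : well_founded lt)
    (v w : W) : lt v w -> olt (orank wf v) (orank wf w).
Proof.
move=> vw; rewrite {2}/orank Fix_eq.
  exact: (@ole_sup_r _ _ (exist _ v vw)) (ole_refl _).
move=> x f g fg; congr osup; apply/funext => y; congr osucc; exact: fg.
Qed.

Section CantorBendixson.
Variable S : topologicalType.

(* The accumulation points of the subspace [A], as a set of points of [S]. *)
Definition derived (A : set S) : set S := A `&` limit_point A.

(* The clause for suprema agrees with the usual one at limit ordinals
   (lemma [cb_deriv_limit]), since the derivatives are decreasing. *)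
Fixpoint cb_deriv (a : Ord) : set S :=
  match a with
  | ozero => [set: S]
  | osucc b => derived (cb_deriv b)
  | osup J f => \bigcap_(i in [set: J]) cb_deriv (f i)
  end.

Lemma cb_deriv_anti (a b : Ord) : ole a b -> cb_deriv b `<=` cb_deriv a.
Proof.
elim: a b => [//|a IHa|J f IHf] b; last first.
  by move=> /= ab x bx i _; exact: IHf (ab i) _ bx.
elim: b => [//|b _ /IHa ba x [bx xb]|J' g IHg /= [j agj] x gx].
  split; first exact: ba.
  by move=> U /xb[y [yx by_ Uy]]; exists y; split=> //; exact: ba.
exact: IHg agj _ (gx j I).
Qed.

Lemma cb_deriv_limit (a : Ord) : olimit a ->
  cb_deriv a = [set x | forall b, olt b a -> cb_deriv b x].
Proof.
move=> la; apply/seteqP; split=> [x ax b ba|].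
  exact: cb_deriv_anti (olt_le ba) _ ax.
elim: a la => [[]//|a _ [_ /(_ a (ole_refl _))/olt_irr[]]|].
move=> J f IHf [a0 aS] x H i _.
have [sfi|fia] := ole_or_gt (osup f) (f i); last exact: H fia.
have fis : ole (f i) (osup f) by exact: ole_sup_r (ole_refl _).
apply: IHf => [|b bfi]; last by apply: H; exact: ole_trans bfi fis.
split=> [|b bfi]; first exact: ole_trans a0 sfi.
by apply: ole_trans sfi; apply: aS; exact: ole_trans bfi fis.
Qed.

Definition is_perfect_kernel (P : set S) : Prop :=
  exists a, forall b, ole a b -> cb_deriv b = P.

(* This lemma also forces the universe of the index types in [Ord] to contain
   that of the carriers of topological spaces, so that there are enough
   ordinals for every space.  As a consequence [set Ord] is not typable. *)
Lemma perfect_kernel_exists : exists P, is_perfect_kernel P.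
Proof.
have /choice[r rP] (x : S) : exists a,
    (exists b, ~ cb_deriv b x) -> ~ cb_deriv a x.
  have [[b bx]|H] := pselect (exists b, ~ cb_deriv b x); first by exists b.
  by exists ozero.
exists (cb_deriv (osup r)), (osup r) => b rb; apply/seteqP; split.
  exact: cb_deriv_anti.
move=> x rx; apply: contrapT => bx.
by have /rP : exists b, ~ cb_deriv b x by [exists b]; apply; exact: rx.
Qed.

Definition scattered : Prop := is_perfect_kernel set0.

(* [ht(S) = a]; thus [ht(S) - 1 = b] is [is_height (osucc b)]. *)
Definition is_height (a : Ord) : Prop :=
  cb_deriv a = set0 /\ forall b, cb_deriv b = set0 -> ole a b.

End CantorBendixson.

Arguments cb_deriv S a : clear implicits.

(* [C(K, E)].  The compactness proof is an argument because the sup norm is a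
   norm only on spaces of bounded functions. *)
Definition Cspace (R : realType) (K : topologicalType)
  (cK : compact [set: K]) (E : normedModType R) : Type := continuousType K E.

Section ContinuousFunctions.
Context {R : realType} {K : topologicalType} {cK : compact [set: K]}.
Context {E : normedModType R}.

HB.instance Definition _ := Choice.on (Cspace cK E).

Implicit Types f g h : Cspace cK E.

Definition cfun (f : K -> E) (cf : continuous f) : Cspace cK E := mkcts cf.

Lemma Cspace_eq f g : f =1 g -> f = g.
Proof. by move/continuousEP. Qed.

Lemma Cspace_cts f : continuous f.
Proof. exact: cts_fun. Qed.

Lemma cts_zero : continuous ((fun=> 0) : K -> E).
Proof. by move=> x; exact: cvg_cst. Qed.

Lemma cts_opp f : continuous (fun x => - f x).
Proof. by move=> x; apply: cvgN; exact: (@Cspace_cts). Qed.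

Lemma cts_add f g : continuous (fun x => f x + g x).
Proof. by move=> x; apply: cvgD; exact: (@Cspace_cts). Qed.

Lemma cts_scale (a : R) f : continuous (fun x => a *: f x).
Proof. by move=> x; apply: cvgZl_tmp; exact: (@Cspace_cts). Qed.

Definition Czero : Cspace cK E := cfun cts_zero.
Definition Copp f : Cspace cK E := cfun (@cts_opp f).
Definition Cadd f g : Cspace cK E := cfun (@cts_add f g).
Definition Cscale (a : R) f : Cspace cK E := cfun (@cts_scale a f).

Let addA : associative Cadd.
Proof. by move=> f g h; apply: Cspace_eq => x; exact: addrA. Qed.
Let addC : commutative Cadd.
Proof. by move=> f g; apply: Cspace_eq => x; exact: addrC. Qed.
Let add0 : left_id Czero Cadd.
Proof. by move=> f; apply: Cspace_eq => x; exact: add0r. Qed.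
Let addN : left_inverse Czero Copp Cadd.
Proof. by move=> f; apply: Cspace_eq => x; exact: addNr. Qed.

HB.instance Definition _ :=
  GRing.isZmodule.Build (Cspace cK E) addA addC add0 addN.

Let scaleA (a b : R) f :
  Cscale a (Cscale b f) = Cscale (a * b) f.
Proof. by apply: Cspace_eq => x; exact: scalerA. Qed.
Let scale1 : left_id 1 Cscale.
Proof. by move=> f; apply: Cspace_eq => x; exact: scale1r. Qed.
Let scaleDr : right_distributive Cscale +%R.
Proof. by move=> a f g; apply: Cspace_eq => x; exact: scalerDr. Qed.
Let scaleDl f : {morph (fun a => Cscale a f) : a b / a + b}.
Proof. by move=> a b; apply: Cspace_eq => x; exact: scalerDl. Qed.

HB.instance Definition _ :=
  GRing.Zmodule_isLmodule.Build R (Cspace cK E) scaleA scale1 scaleDr scaleDl.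

Definition sup_norm f : R := sup [set `|f x| | x in [set: K]].

Lemma Cspace_bounded f : has_ubound [set `|f x| | x in [set: K]].
Proof.
have cnf : continuous (fun x => `|f x|).
  move=> x; apply: cvg_norm; exact: (@Cspace_cts).
have : compact ((fun x => `|f x|) @` [set: K]).
  by apply: continuous_compact => //; exact: continuous_subspaceT.
move=> /compact_bounded[M [_ HM]]; exists (M + 1) => y fy.
by apply: le_trans (ler_norm y) _; apply: HM => //; rewrite ltrDl.
Qed.

Lemma le_sup_norm f (x : K) : `|f x| <= sup_norm f.
Proof. by apply: (ub_le_sup (Cspace_bounded f)); exists x. Qed.

Lemma sup_norm_le f (M : R) : 0 <= M -> (forall x, `|f x| <= M) ->
  sup_norm f <= M.
Proof.
move=> M0 fM; have [[x _]|/nonemptyPn K0] := pselect ([set: K] !=set0).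
  by apply: ge_sup => [|_ [y _ <-]//]; exists `|f x|, x.
by rewrite /sup_norm K0 image_set0 sup0.
Qed.

Let sup_norm_ge0 f : 0 <= sup_norm f.
Proof.
have [[x _]|/nonemptyPn K0] := pselect ([set: K] !=set0).
  exact: le_trans (le_sup_norm f x).
by rewrite /sup_norm K0 image_set0 sup0.
Qed.

Let sup_normD f g : sup_norm (f + g) <= sup_norm f + sup_norm g.
Proof.
apply: sup_norm_le => [|x]; first by rewrite addr_ge0.
by apply: le_trans (ler_normD _ _) _; rewrite lerD// le_sup_norm.
Qed.

Let sup_normZ (a : R) f : sup_norm (a *: f) = `|a| * sup_norm f.
Proof.
have le_Z (b : R) g : sup_norm (b *: g) <= `|b| * sup_norm g.
  apply: sup_norm_le => [|x]; first by rewrite mulr_ge0.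
  by rewrite normrZ ler_wpM2l// le_sup_norm.
apply/eqP; rewrite eq_le le_Z/=.
have [->|a0] := eqVneq a 0; first by rewrite normr0 mul0r.
rewrite mulrC -ler_pdivlMr ?normr_gt0// mulrC -normfV.
by rewrite -[in leLHS](scale1r f) -(mulVf a0) -scalerA.
Qed.

Let sup_norm0_eq0 f : sup_norm f = 0 -> f = 0.
Proof.
move=> f0; apply: Cspace_eq => x; apply/eqP.
by rewrite -normr_le0 -f0 le_sup_norm.
Qed.

HB.instance Definition _ :=
  Lmodule_isNormed.Build R (Cspace cK E) sup_normD sup_normZ sup_norm0_eq0.

Lemma Cspace_normE f : `|f| = sup_norm f.
Proof. by []. Qed.

End ContinuousFunctions.

Section Embeddings.
Context {R : realType}.

Definition isometric (X Y : normedModType R) (T : X -> Y) : Prop :=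
  forall x, `|T x| = `|x|.

Definition isometric_copy (X Y : normedModType R) : Prop :=
  exists T : {linear X -> Y}, isometric T.

Definition positive_isometric_copy (L K : topologicalType)
    (cL : compact [set: L]) (cK : compact [set: K]) : Prop :=
  exists T : {linear Cspace cL R -> Cspace cK R}, isometric T /\
    forall f : Cspace cL R, (forall x, 0 <= f x) -> forall y, 0 <= T f y.

(* Operators defined on a subset [D] of a normed space; outside [D] the values
   are irrelevant. *)
Definition bounded_operator (X Y : normedModType R) (D : set X) (T : X -> Y) :
    Prop :=
  exists M : R, forall x, D x -> `|T x| <= M * `|x|.

Definition operator_norm (X Y : normedModType R) (D : set X) (T : X -> Y) : R :=
  sup [set `|T x| | x in [set x | D x /\ `|x| <= 1]].

(* [Tinv] is determined by [T] on [range T], and only matters there. *)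
Definition isomorphic_embedding (X Y : normedModType R) (T : {linear X -> Y})
    (Tinv : Y -> X) : Prop :=
  [/\ cancel T Tinv, bounded_operator [set: X] T &
      bounded_operator (range T) Tinv].

Definition strictly_convex (E : normedModType R) : Prop :=
  forall x y : E, `|x| = 1 -> `|y| = 1 -> x != y -> `|2^-1 *: (x + y)| < 1.

End Embeddings.

(* Main.v *)
Require Import Defs.
From HB Require Import structures.
From mathcomp Require Import all_boot all_order all_algebra finmap.
From mathcomp Require Import all_classical all_reals all_analysis.
From mathcomp Require Import ring lra.
Import Order.TTheory GRing.Theory Num.Theory.
Import numFieldNormedType.Exports.
Local Open Scope classical_set_scope.
Local Open Scope ring_scope.

(* A continuous map of a closed subset of [K] onto [L] amounts to a closed
   subset of [K * L] that is the graph of a partial function onto [L].  This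
   is how continuity is obtained in the first two steps.

   From an isometry to a map.  Let [T : C(L) -> C(K, E)] be an isometry with
   [E] strictly convex.  For each [y] there is a point [k] where all [T f]
   with [f y = 1 = |f|] have norm 1 and, by strict convexity, the same value.
   If [|h| <= 1] and [h y = 0], then [1 - |h|] and [1 - |h| + h] are two such
   [f], so [T h k = 0].  Hence [T f k = f y *: T 1 k] for all [f], and such
   pairs [(k, y)] form the graph of the required map.

   From heights to a map.  If [K] is nonscattered, a Cantor scheme in its
   perfect kernel maps a closed subset of [K] onto the Cantor space, which maps
   onto [L].  If [L] is scattered, induction on [b] shows that near a point of
   [K^(b)] there is a closed set that maps onto any closed [A] such that
   [A] meets [L^(b)] in at most one point [y]: cut [A] into annuli around [y],
   each of which is a finite union of pieces of smaller rank.

   From a map to a positive isometry.  With [x_n] dense in [L] and [G_n]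
   extending [d(x_n, phi z)] to [K], put
   [D z l = sum_n 2^-n |G_n z - d(x_n, l)|] and [m z = min_l D z l].  The
   average of the [f (x_n)] with weights [2^-n max(0, 2 m z - D z x_n)], or the
   value of [f] at the unique zero of [D z] if [m z = 0], extends [f \o phi]
   continuously to [K].

   From distortion less than 3 to heights.  Suppose
   [a |f| <= |T f| <= M |f|] with [M < 3 a].  If [|g| <= 1] and [f] is a
   bump at [y], where [g y = 1], then [g + 2 f] has norm 3, so that at some [k]
   [|T (g + 2 f) k| >= 3 a].  Then [|T h k| >= (3 a - M) / 2] whenever
   [|g + 2 f - 2 h| <= 1].  Such points [k] exist in [K^(b)] if [y] is in
   [L^(b)], by induction on [b]: the values of [T] at [k] on disjoint bumps are
   summable, so that infinitely many bumps yield infinitely many points [k]. *)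

Set Implicit Arguments.
Unset Strict Implicit.
Unset Printing Implicit Defensive.

(** * Compactness and closed graphs *)

(** If [Q A] failed, the sets [A \ B] with [Q B] would generate a proper filter, and the local
    hypothesis at a cluster point of it in [A] would be contradicted. *)
Lemma compact_set_ind (T : topologicalType) (A : set T) (Q : set T -> Prop) :
  compact A -> Q set0 -> (forall U V, U `<=` V -> Q V -> Q U) ->
  (forall U V, Q U -> Q V -> Q (U `|` V)) ->
  (forall x, A x -> exists2 U, nbhs x U & Q U) -> Q A.
Proof.
move=> cA Q0 QS QU locQ; apply: contrapT => nQA.
pose F := [set S | exists2 B, Q B & A `\` B `<=` S].
have FF : ProperFilter F.
  split=> [[B QB AB]|].
    by apply/nQA/QS/QB => x Ax; apply: contrapT => nBx; exact: (AB x).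
  split=> [|S S' [B QB AB] [B' QB' AB']|S S' SS' [B QB AB]].
  - by exists set0.
  - exists (B `|` B'); first exact: QU.
    by move=> x [Ax /not_orP[nB nB']]; split; [exact: AB|exact: AB'].
  - by exists B => //; exact: subset_trans SS'.
have [x [Ax clx]] : A `&` cluster F !=set0.
  by apply: cA; exists set0 => // x [].
have [U xU QUx] := locQ x Ax.
have FAU : F (A `\` U) by exists U.
by have [y [[_ nUy] Uy]] := clx _ _ FAU xU.
Qed.

Lemma compact_directed_meet (T : topologicalType) (I : Type) (C : I -> set T) :
  compact [set: T] -> inhabited I -> (forall i, closed (C i)) ->
  (forall i, C i !=set0) ->
  (forall i j, exists k, C k `<=` C i /\ C k `<=` C j) ->
  exists x, forall i, C i x.
Proof.
move=> cT [i0] clC C0 dC.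
have FF : ProperFilter (filter_from [set: I] C).
  apply: filter_from_proper => [|i _]; last exact: C0.
  apply: filter_from_filter; first by exists i0.
  move=> i j _ _; have [k [ki kj]] := dC i j.
  by exists k => // x kx; split; [exact: ki|exact: kj].
have [x [_ clx]] : [set: T] `&` cluster (filter_from [set: I] C) !=set0.
  by apply: cT; exists i0.
exists x => i; apply: clC => U xU; apply: clx => //; by exists i.
Qed.

Section ClosedRelations.
Context {K L : topologicalType}.
Implicit Types G : set (K * L).

Definition functional G := forall z l l', G (z, l) -> G (z, l') -> l = l'.

(** Projection along the compact factor [L] is a closed map: that no [l] in [C] is paired with [z]
    persists near [z]. *)
Lemma closed_section G (C : set L) : compact [set: L] -> closed G -> closed C ->
  closed [set z | exists2 l, C l & G (z, l)].
Proof.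
move=> /compact_near_coveringP cL clG clC; rewrite -openC.
rewrite openE => z nz.
have H : \forall z' \near z, [set: L] `<=` (fun l => ~ (C l /\ G (z', l))).
  apply: cL => l _.
  have [Cl|nCl] := pselect (C l); last first.
    exists (~` C, setT); last by move=> [l' z'] [/= nC' _] [].
    by split; [apply: open_nbhs_nbhs; split => //;
      exact: closed_openC|exact: filterT].
  have nG : (~` G) (z, l) by move=> Gzl; apply: nz; exists l.
  have : nbhs (z, l) (~` G).
    by apply: open_nbhs_nbhs; split=> //; exact: closed_openC.
  move=> [[A B] [/= zA lB] AB]; exists (B, A) => // -[l' z'] [/= Bl' Az'] [_].
  exact: (AB (z', l')).
by apply: filterS H => z' H [l Cl Gl]; exact: (H l).
Qed.

(** Preimages of closed sets under [phi] are sections of [G], hence closed by [closed_section].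
    Outside [F] the value of [phi] is [l0]. *)
Lemma continuous_of_closed_relation G (l0 : L) : compact [set: L] -> closed G ->
  functional G -> (forall l, exists z, G (z, l)) ->
  exists (F : set K) (phi : K -> L),
    [/\ closed F, {within F, continuous phi} & phi @` F = [set: L]].
Proof.
move=> cL clG fG sG.
have [phi phiP] : {phi : K -> L & forall z l, G (z, l) -> phi z = l}.
  apply: (@choice _ _ (fun z y => forall l, G (z, l) -> y = l)) => z.
  have [[l Gl]|nG] := pselect (exists l, G (z, l)).
    by exists l => l' Gl'; exact: fG Gl Gl'.
  by exists l0 => l Gl; case: nG; exists l.
pose F := [set z | exists l, G (z, l)].
have GE z : F z -> G (z, phi z) by move=> [l Gl]; rewrite (phiP _ _ Gl).
exists F, phi; split.
- have := closed_section cL clG closedT.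
  by congr closed; apply/seteqP; split=> z [l]; exists l.
- apply/continuousP => U oU.
  rewrite -[phi @^-1` U]setCK; apply: closed_openC.
  apply/closed_subspaceP.
  exists [set z | exists2 l, (~` U) l & G (z, l)].
    by apply: closed_section => //; exact: open_closedC.
  apply/seteqP; split=> z [/=].
    by move=> [l nUl Gl] Fz; split=> //; rewrite (phiP _ _ Gl).
  by move=> nU Fz; split=> //; exists (phi z) => //; exact: GE.
- apply/seteqP; split=> // l _; have [z Gz] := sG l.
  by exists z; [exists l|exact: phiP].
Qed.

End ClosedRelations.

(** * Cantor-Bendixson derivatives of compact spaces *)

Section Derivatives.
Variable S : topologicalType.
Implicit Types (a b : Ord) (A : set S).

Lemma derived_closed A : hausdorff_space S -> closed A -> closed (derived A).
Proof.
move=> hS clA; apply: closedI => //; apply: limit_point_closed.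
exact: hausdorff_accessible.
Qed.

Lemma cb_deriv_closed a : hausdorff_space S -> closed (cb_deriv S a).
Proof.
move=> hS; elim: a => [|a IHa|J f IHf]; first exact: closedT.
  exact: derived_closed.
by apply: closed_bigI => i _; exact: IHf.
Qed.

(** Ordinals are comparable and derivatives decrease, so the sets in question form a chain of
    nonempty closed sets. Nonemptiness of [C] settles an empty index type. *)
Lemma cb_deriv_sup (J : Type) (f : J -> Ord) (C : set S) :
  compact [set: S] -> hausdorff_space S -> closed C -> C !=set0 ->
  (forall i, C `&` cb_deriv S (f i) !=set0) ->
  C `&` cb_deriv S (osup f) !=set0.
Proof.
move=> cS hS clC [c Cc] Cf.
have [[j0]|J0] := pselect (inhabited J); last first.
  by exists c; split=> // i; case: J0.
have [||||x Hx] := @compact_directed_meet S J (fun i =>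
  C `&` cb_deriv S (f i)) cS.
- by [].
- by move=> i; apply: closedI => //; exact: cb_deriv_closed.
- exact: Cf.
- move=> i j; have [fij|/olt_le fji] := ole_or_gt (f i) (f j).
    exists j; split=> // x [Cx fx]; split=> //; exact: cb_deriv_anti fij _ fx.
  exists i; split=> // x [Cx fx]; split=> //; exact: cb_deriv_anti fji _ fx.
by exists x; split; [case: (Hx j0)|move=> i _; case: (Hx i)].
Qed.

Lemma not_derivedP A x : A x -> ~ derived A x ->
  exists2 U, nbhs x U & A `&` U `<=` [set x].
Proof. by move=> Ax nd; rewrite -not_limit_pointE => lx; exact: nd. Qed.

Lemma finite_no_derived A : compact [set: S] -> closed A -> derived A = set0 ->
  finite_set A.
Proof.
move=> cS clA dA; rewrite -[A]setIid.
apply: (@compact_set_ind _ A (fun U => finite_set (A `&` U))).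
- exact: subclosed_compact cS _.
- by rewrite setI0.
- by move=> U V UV; apply: sub_finite_set => x [Ax /UV].
- by move=> U V fU fV; rewrite setIUr finite_setU.
- move=> x Ax; have [|U xU AU] := @not_derivedP A x Ax; first by rewrite dA.
  by exists U => //; exact: sub_finite_set AU (finite_set1 _).
Qed.

(** This [b] is the rank of [x]: a point missing at a supremum is already missing at some member of
    the family, so points are lost at successors only. *)
Lemma cb_rank a x : ~ cb_deriv S a x ->
  exists2 b, olt b a & cb_deriv S b x /\ ~ cb_deriv S (osucc b) x.
Proof.
elim: a => [[]//|a IHa|J f IHf].
  have [ax nSax|nax _] := pselect (cb_deriv S a x).
    by exists a => //; exact: ole_refl.
  have [b ba bx] := IHa nax; exists b => //; apply: ole_trans ba _.
  exact: ole_osucc.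
move=> nfx; have [i nfi] : exists i, ~ cb_deriv S (f i) x.
  by apply: contrapT => H; apply: nfx => i _; apply: contrapT => ?; apply: H;
    exists i.
by have [b bf bx] := IHf i nfi; exists b => //; exact: ole_sup_r bf.
Qed.

(** By [cb_deriv_sup], the derivatives cannot become empty for the first time at a supremum. *)
Lemma height_exists a : compact [set: S] -> hausdorff_space S ->
  [set: S] !=set0 -> cb_deriv S a = set0 ->
  exists b, cb_deriv S (osucc b) = set0 /\ cb_deriv S b !=set0.
Proof.
move=> cS hS [x0 _]; elim: a => [S0|a IHa a0|J f IHf f0].
- by have : cb_deriv S ozero x0 by []; rewrite S0.
- by have [/IHa//|/eqP/set0P[x ax]] := pselect (cb_deriv S a = set0); exists a;
    split=> //; exists x.
have [i fi] : exists i, cb_deriv S (f i) = set0; last exact: IHf fi.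
apply: contrapT => H.
have [x [_]] : setT `&` cb_deriv S (osup f) !=set0; last by rewrite f0.
apply: cb_deriv_sup => //; [by exists x0|move=> i].
by rewrite setTI; apply/set0P/eqP => fi; apply: H; exists i.
Qed.

Lemma height_succ b : cb_deriv S (osucc b) = set0 -> cb_deriv S b !=set0 ->
  is_height S (osucc b).
Proof.
move=> b0 [x bx]; split=> // c c0; have [//|cb] := ole_or_gt (osucc b) c.
by have := @cb_deriv_anti S c b cb x bx; rewrite c0.
Qed.

End Derivatives.

Lemma perfect_kernel_nonempty (S : topologicalType) : ~ scattered S ->
  exists P : set S, [/\ P !=set0, derived P = P & exists a, P = cb_deriv S a].
Proof.
move=> nS; have [P [a aP]] := perfect_kernel_exists S; exists P; split.
- by apply/set0P/eqP => P0; apply: nS; exists a; rewrite -P0.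
- by rewrite -{1}(aP a (ole_refl a)); exact: aP (osucc a) (ole_osucc a).
- by exists a; rewrite aP//; exact: ole_refl.
Qed.

(** In the successor case, suppose that the fibre [Z] over [y] misses K^(a+1). Then near [Z] all
    points of K^(a) lie in [Z]. But the fibre over some [y' != y] close to [y] lies near [Z] and
    meets K^(a) by induction. *)
Lemma cb_deriv_image (K L : topologicalType) (F : set K) (phi : K -> L) a y :
  compact [set: K] -> hausdorff_space K -> hausdorff_space L -> closed F ->
  {within F, continuous phi} -> phi @` F = [set: L] -> cb_deriv L a y ->
  [set z | F z /\ phi z = y] `&` cb_deriv K a !=set0.
Proof.
move=> cK hK hL clF cphi sphi.
have im_closed C : closed C -> C `<=` F -> closed (phi @` C).
  move=> clC CF; apply: compact_closed => //; apply: continuous_compact.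
    exact: continuous_subspaceW cphi.
  exact: subclosed_compact cK _.
have fib_closed u : closed [set z | F z /\ phi z = u].
  have /continuousP/= := cphi.
  have clu : closed [set u].
    exact: accessible_closed_set1 (hausdorff_accessible hL) _.
  move=> /(_ (~` [set u]) (closed_openC clu)).
  rewrite -[_ @^-1` _]setCK openC => /closed_subspaceP[V clV].
  move=> VF; have -> : [set z | F z /\ phi z = u] = V `&` F.
    rewrite VF; apply/seteqP; split=> z /=.
      by move=> [Fz zu]; split => // /(_ zu).
    by move=> [nn Fz]; split=> //; apply: contrapT => /nn.
  exact: closedI.
have fib0 u : [set z | F z /\ phi z = u] !=set0.
  have : (phi @` F) u by rewrite sphi.
  by move=> [z Fz zu]; exists z.
elim: a y => [|a IHa|J f IHf] y; first by rewrite setIT.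
  move=> [ay ly]; apply: contrapT => H.
  pose Z := [set z | F z /\ phi z = y].
  (* The open set [N] contains [Z], as each point of [Z] is isolated in K^(a) or outside this closed
     set. *)
  pose N := \bigcup_(U in [set U | open U /\ U `&` cb_deriv K a `<=` Z]) U.
  have oN : open N by apply: bigcup_open => U [].
  have ZN : Z `<=` N.
    move=> z Zz; have [az|naz] := pselect (cb_deriv K a z).
      have [|U zU aU] := not_derivedP az; first by move=> dz; apply: H;
        exists z.
      exists U°; last by apply: nbhs_singleton; exact: nbhs_interior.
      split; first exact: open_interior.
      move=> w [/interior_subset Uw aw].
      by have /= -> := aU w (conj aw Uw).
    exists (~` cb_deriv K a) => //; split; last by move=> w [].
    exact/closed_openC/cb_deriv_closed.
  have clFN : closed (phi @` (F `\` N)).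
    apply: im_closed; last by move=> ? [].
    by apply: closedI => //; exact: open_closedC.
  have [|y' [y'y ay' ny']] := ly (~` (phi @` (F `\` N))).
    apply: open_nbhs_nbhs; split; first exact: closed_openC.
    by move=> [z [Fz nNz] zy]; apply/nNz/ZN.
  have [z [[Fz zy'] az]] := IHa y' ay'.
  have [[U [_ UZ] Uz]|nNz] := pselect (N z).
    by have [_ zy] := UZ z (conj Uz az); move/eqP: y'y; rewrite -zy' -zy.
  by apply: ny'; exists z.
move=> fy; apply: cb_deriv_sup => // i; apply: IHf; exact: fy.
Qed.

(** * Realizing scattered spaces *)

Lemma separate_finite (T : topologicalType) (I : finType) (p : I -> T) :
  hausdorff_space T -> injective p ->
  exists W : I -> set T, (forall i, nbhs (p i) (W i)) /\
    forall i j x, W i x -> W j x -> i = j.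
Proof.
move=> hT ip.
have sep (ij : I * I) : exists AB : set T * set T, ij.1 != ij.2 ->
    [/\ nbhs (p ij.1) AB.1, nbhs (p ij.2) AB.2 & AB.1 `&` AB.2 = set0].
  case: ij => i j; have [->|ij] /= := eqVneq i j; first by exists (set0, set0).
  move: hT; rewrite open_hausdorff => /(_ (p i) (p j)).
  rewrite (inj_eq ip) => /(_ ij)[[A B] [/= /set_mem Ai /set_mem Bj]].
  move=> [oA oB /eqP AB0]; exists (A, B) => _.
  by split=> //; exact: open_nbhs_nbhs.
have [S SP] := choice sep.
exists (fun i => [set x | forall j, i != j ->
    (S (i, j)).1 x /\ (S (j, i)).2 x]).
split=> [i|i j x Wi Wj].
  apply: filter_forall => j; have [->|ij] := eqVneq i j.
    by apply: filterE.
  have [Aij _ _] := SP (i, j) ij.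
  have [|_ Bji _] := SP (j, i); first by rewrite eq_sym.
  by apply: filterS2 Aij Bji => x.
apply/eqP/negP => /negP ij; have [_ _] := SP (i, j) ij.
have [Aij _] := Wi j ij; have [|_ Bij] := Wj i; first by rewrite eq_sym.
by move/seteqP => [/(_ x) + _]; apply.
Qed.

Lemma closed_setX (T U : topologicalType) (A : set T) (B : set U) :
  closed A -> closed B -> closed (A `*` B).
Proof.
move=> clA clB; rewrite (_ : A `*` B = fst @^-1` A `&` snd @^-1` B)//.
apply: closedI; apply: preimage_closed => // p _;
  [exact: cvg_fst|exact: cvg_snd].
Qed.

Section MetricFacts.
Context {R : realType} {L : metricType R}.
Implicit Types (x y : L).

Lemma mdist_lip x y z : `|mdist x y - mdist x z| <= mdist y z :> R.
Proof.
have := metric_triangle x y z; have := metric_triangle x z y.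
by rewrite (metric_sym z y) ler_norml; lra.
Qed.

Lemma continuous_mdist x : continuous (mdist x : L -> R).
Proof.
move=> y; apply/cvgrPdist_lt => e e0.
have : nbhs y (ball y e) by exact: nbhsx_ballx.
apply: filterS => z; rewrite ballEmdist/= => yz.
exact: le_lt_trans (mdist_lip x y z) yz.
Qed.

End MetricFacts.

(** * Covering closed subsets of [L] from neighbourhoods of points of [K] *)

Section Realization.
Context {R : realType} {L : metricType R} {K : topologicalType}.
Hypothesis cL : compact [set: L].
Hypothesis cK : compact [set: K].
Hypothesis hK : hausdorff_space K.
Implicit Types (A : set L) (W : set K) (G : set (K * L)) (y : L) (k : K).

Let hL : hausdorff_space L := @metric_hausdorff R L.

(* [G] is the graph of a continuous map from a closed subset of [W] to [L]
   whose image contains [A]. *)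
Definition covers G W A :=
  [/\ closed G, functional G, forall z l, G (z, l) -> W z &
      forall l, A l -> exists z, G (z, l)].

Lemma covers_restrict G W A : closed A -> covers G W A ->
  exists2 G', covers G' W A & forall z l, G' (z, l) -> A l.
Proof.
move=> clA [clG fG GW GA]; exists (G `&` [set p | A p.2]);
  last by move=> z l [].
split=> [|z l l' [Gl _] [Gl' _]|z l [/GW]|l Al] //.
- apply: closedI => //; rewrite -[[set p | A p.2]]/(snd @^-1` A).
  by apply: preimage_closed => // p _; exact: cvg_snd.
- exact: fG Gl Gl'.
- by have [z Gz] := GA l Al; exists z.
Qed.

(* [A] can be covered near [k] without using up all of a neighbourhood. *)
Definition coverable k A := forall W, nbhs k W ->
  exists W' G, [/\ nbhs k W', W' `<=` W & covers G (W `\` closure W') A].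

Lemma coverableS k A A' : A `<=` A' -> coverable k A' -> coverable k A.
Proof.
move=> AA' cA W kW; have [W' [G [kW' W'W [clG fG GW GA]]]] := cA W kW.
by exists W', G; split=> //; split=> // l /AA'; exact: GA.
Qed.

Lemma coverable0 k : coverable k set0.
Proof.
move=> W kW; exists W, set0; split=> //; split=> //; exact: closed0.
Qed.

Lemma coverableU k A A' : coverable k A -> coverable k A' ->
  coverable k (A `|` A').
Proof.
move=> cA cA' W kW; have [W1 [G1 [kW1 W1W [clG1 fG1 GW1 GA1]]]] := cA W kW.
have [W2 [G2 [kW2 W21 [clG2 fG2 GW2 GA2]]]] := cA' W1 kW1.
have cW21 : closure W2 `<=` closure W1 by exact: closureS.
exists W2, (G1 `|` G2); split=> //; first exact: subset_trans W1W.
split.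
- exact: closedU.
- move=> z l l' [Gl|Gl] [Gl'|Gl']; [exact: fG1 Gl Gl'| | |exact: fG2 Gl Gl'].
    have [_ []] := GW1 _ _ Gl; apply: subset_closure.
    by have [] := GW2 _ _ Gl'.
  have [_ []] := GW1 _ _ Gl'; apply: subset_closure.
  by have [] := GW2 _ _ Gl.
- move=> z l [/GW1[Wz nW]|/GW2[/W1W Wz nW]]; split=> //.
  by move=> /cW21.
- by move=> l [/GA1[z Gz]|/GA2[z Gz]]; exists z; [left|right].
Qed.

(** Multiplying by [n] instead of comparing with [1/n] makes the ball of index 0 the whole space. *)
Let dn n (y l : L) : R := n%:R * mdist y l.

Lemma closed_dn_le n y : closed [set l | dn n y l <= 1].
Proof.
apply: (@preimage_closed _ _ (dn n y) [set x | x <= 1]); last exact: closed_le.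
by move=> l _; apply: cvgM; [exact: cvg_cst|exact: continuous_mdist].
Qed.

Lemma closed_dn_ge n y : closed [set l | 1 <= dn n y l].
Proof.
apply: (@preimage_closed _ _ (dn n y) [set x | 1 <= x]); last exact: closed_ge.
by move=> l _; apply: cvgM; [exact: cvg_cst|exact: continuous_mdist].
Qed.

(* The graph is the intersection over [N] of the closed sets
   [G_0 U ... U G_(N-1) U (cl W_N x B_N)], where [G_n] covers the annulus
   [1/(n+1) <= d(y, l) <= 1/n] of [A] and [B_N] is the ball of radius [1/N]. *)
Lemma covers_of_annuli k y A W : closed A -> nbhs k W ->
  (forall n, coverable k (A `&` [set l | 1 <= dn n.+1 y l])) ->
  exists G, covers G W A.
Proof.
move=> clA kW cov.
pose B n := [set l | dn n y l <= 1].
pose An n := A `&` [set l | 1 <= dn n.+1 y l] `&` B n.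
have clAn n : closed (An n).
  apply: closedI; last exact: closed_dn_le.
  by apply: closedI => //; exact: closed_dn_ge.
have stepP (nV : nat * set K) : exists WG : set K * set (K * L), nbhs k nV.2 ->
    [/\ nbhs k WG.1, WG.1 `<=` nV.2,
        covers WG.2 (nV.2 `\` closure WG.1) (An nV.1) &
        forall z l, WG.2 (z, l) -> An nV.1 l].
  case: nV => n V /=; have [kV|nkV] := pselect (nbhs k V); last first.
    by exists (set0, set0).
  have : coverable k (An n) by apply: coverableS (cov n) => l [].
  move=> /(_ V kV)[W' [G [kW' W'V /(covers_restrict (clAn n))[G' cG' GA]]]].
  by exists (W', G').
have [step stepE] := choice stepP.
have [W0 kW0 W0W] : exists2 W0, nbhs k W0 & closure W0 `<=` W.
  have := @compact_regular K k setT hK cK filterT W kW.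
  by move=> [V kV VW]; exists V.
pose Wn := fix Wn n := if n is m.+1 then (step (m, Wn m)).1 else W0.
pose Gn n := (step (n, Wn n)).2.
have kWn n : nbhs k (Wn n).
  by elim: n => //= n kn; have [] := stepE (n, Wn n) kn.
have WS n : Wn n.+1 `<=` Wn n by have [] := stepE (n, Wn n) (kWn n).
have GnP n : covers (Gn n) (Wn n `\` closure (Wn n.+1)) (An n).
  by have [] := stepE (n, Wn n) (kWn n).
have GnA n z l : Gn n (z, l) -> An n l.
  by have [_ _ _] := stepE (n, Wn n) (kWn n); exact.
have Wmono m n : (m <= n)%N -> Wn n `<=` Wn m.
  move=> /subnKC <-; elim: (n - m)%N => [|i IHi]; first by rewrite addn0.
  by rewrite addnS; exact: subset_trans (WS _) IHi.
have Bmono m n : (m <= n)%N -> B n `<=` B m.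
  move=> mn l; apply: le_trans; rewrite ler_wpM2r ?mdist_ge0//.
  by rewrite ler_nat.
pose U N := [set p | exists2 n, (n < N)%N & Gn n p].
have clU N : closed (U N).
  elim: N => [|N IHN].
    by rewrite (_ : U 0%N = set0); [exact: closed0|apply/seteqP;
      split=> p // []].
  rewrite (_ : U N.+1 = U N `|` Gn N); first by apply: closedU => //;
    case: (GnP N).
  apply/seteqP; split=> p.
    by move=> [n]; rewrite ltnS leq_eqVlt => /orP[/eqP ->|nN Gp]; [right|left;
      exists n].
  move=> [[n nN Gp]|Gp]; [by exists n => //; exact: ltnW|by exists N].
pose H N := U N `|` (closure (Wn N) `*` B N).
have domG n N z l : Gn n (z, l) -> (n < N)%N -> ~ closure (Wn N) z.
  have [_ _ /(_ z l) + _] := GnP n => /[apply] -[_ nW] nN.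
  by apply: contra_not nW; apply: closureS; exact: Wmono.
have kW_ n z l : Gn n (z, l) -> Wn n z.
  by have [_ _ /(_ z l) + _] := GnP n => /[apply] -[].
exists (\bigcap_N H N); split.
- apply: closed_bigI => N _; apply: closedU => //.
  apply: closed_setX; [exact: closed_closure|exact: closed_dn_le].
(* The point [z] is outside [closure (Wn n.+1)], so [H n.+1] puts [(z, l)] in some [Gn i] with
   [i <= n]; the case [i < n] is excluded because [z] is in [Wn n]. *)
- have one_n z l n l0 : Gn n (z, l0) -> (forall N, H N (z, l)) -> l = l0.
    move=> Gz /(_ n.+1)[[i iN Gi]|[/= cz _]];
      last by case: (domG _ n.+1 _ _ Gz).
    have [ni|ni|ni] := ltngtP n i; last by
      rewrite ni in Gz; have [_ fG _ _] := GnP i; exact: fG Gi Gz.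
      by move: iN; rewrite ltnS leqNgt ni.
    case: (domG _ n _ _ Gi ni); apply: subset_closure; exact: kW_ Gz.
  move=> z l l' Hl Hl'.
  have [[n [l0 Gz]]|nG] := pselect (exists n l0, Gn n (z, l0)).
    rewrite (one_n z l n l0 Gz); last by move=> N; exact: Hl.
    by rewrite (one_n z l' n l0 Gz) // => N; exact: Hl'.
  (* Outside the domains of all [Gn n], only points of [B N] are left by [H N], and these balls
     shrink to [y]. *)
  have isy u : (\bigcap_N H N) (z, u) -> u = y.
    move=> Hu; apply/esym/mdist_positivity/eqP; rewrite eq_le mdist_ge0 andbT.
    rewrite leNgt; apply/negP => d0.
    have := truncnS_gt (1 / mdist y u).
    set N := (Num.trunc _).+1; rewrite ltr_pdivrMr// => dN.
    have [[i _ Gi]|[_ /=]] := Hu N I; first by apply: nG; exists i, u.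
    by rewrite /B/= /dn leNgt dN.
  by rewrite (isy l)// (isy l').
- move=> z l /(_ 0%N I)[[]//|[/= + _]]; exact: W0W.
- move=> l Al.
  have [->|ly] := eqVneq l y.
    exists k => N _; right; split=> /=;
      last by rewrite /B /= /dn mdistxx mulr0 ler01.
    exact: subset_closure (nbhs_singleton (kWn N)).
  have [n An_l] : exists n, An n l.
    have d0 : 0 < mdist y l by rewrite mdist_gt0 eq_sym.
    have ex : exists n, 1 <= dn n.+1 y l.
      exists (Num.trunc (1 / mdist y l)); rewrite /dn.
      by rewrite -ler_pdivrMr// ltW// truncnS_gt.
    case: (ex_minnP ex) => n dn1 dmin; exists n; split => //.
    rewrite /B /=; case: n dn1 dmin => [|n] dn1 dmin.
      by rewrite /dn mul0r ler01.
    rewrite leNgt; apply/negP => /ltW /dmin; by rewrite ltnn.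
  have [_ _ _ /(_ l An_l)[z Gz]] := GnP n; exists z => N _.
  have [nN|Nn] := ltnP n N; first by left; exists n.
  right; split=> /=.
    by apply/subset_closure/(Wmono N n) => //; exact: kW_ Gz.
  by apply: (Bmono N n) => //; have [] := GnA _ _ _ Gz.
Qed.

(** A point [x] of [A] has a rank [c] below [b], so a closed neighbourhood of [x] meets L^(c) in [x]
    only. As K^(c) accumulates at [k], this neighbourhood is covered near another point [k'] of
    K^(c). Compactness of [A] combines such pieces. *)
Lemma coverable_of_rank k b A : compact A -> cb_deriv K b k ->
  A `&` cb_deriv L b = set0 ->
  (forall c, olt c b -> forall k' W A' y, cb_deriv K c k' -> nbhs k' W ->
    closed A' -> A' `&` cb_deriv L c `<=` [set y] -> exists G, covers G W A') ->
  coverable k A.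
Proof.
move=> cA bk Ab0 IH; apply: (compact_set_ind cA).
- exact: coverable0.
- exact: coverableS.
- exact: coverableU.
move=> x Ax; have nbx : ~ cb_deriv L b x.
  by move=> bx; have : (A `&` cb_deriv L b) x by []; rewrite Ab0.
have [c cb [cx nScx]] := cb_rank nbx.
have [U xU cU] := not_derivedP cx nScx.
have [V xV VU] := @compact_regular L x setT hL cL filterT U xU.
exists V => // W kW.
have [_ lk] : cb_deriv K (osucc c) k by exact: cb_deriv_anti cb _ bk.
have [k' [k'k ck' Wk']] := lk W° (nbhs_interior kW).
move: hK; rewrite open_hausdorff =>
  /(_ _ _ k'k)[[W1 W2] /= [/set_mem W1k' /set_mem W2k]].
move=> [oW1 oW2 /eqP W12].
have [|||G [clG fG GW GA]] := IH c cb k' (W1 `&` W) (closure V) x ck'.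
- by apply: filterI; [exact: open_nbhs_nbhs|exact: Wk'].
- exact: closed_closure.
- by move=> u [/VU Uu cu]; exact: cU.
exists (W2 `&` W), G; split.
- by apply: filterI => //; exact: open_nbhs_nbhs.
- by move=> z [].
- split=> // [z l /GW[W1z Wz]|l Vl]; last exact/GA/subset_closure.
  split=> // clz; have [u [[W2u _] W1u]] := clz W1 (open_nbhs_nbhs (conj oW1
    W1z)).
  by have : (W1 `&` W2) u by []; rewrite W12.
Qed.

(** The part of [A] away from [y] misses L^(b), so [coverable_of_rank] with the induction hypothesis
    provides the annuli. *)
Lemma covers_of_rank b k W A y : cb_deriv K b k -> nbhs k W -> closed A ->
  A `&` cb_deriv L b `<=` [set y] -> exists G, covers G W A.
Proof.
elim: b / (olt_wf b) k W A y => b _ IH k W A y bk kW clA Ab.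
apply: (covers_of_annuli (k := k) (y := y)) => // n.
have clAn : closed (A `&` [set l | 1 <= dn n.+1 y l]).
  by apply: closedI => //; exact: closed_dn_ge.
apply: (coverable_of_rank _ bk) => //; first exact: subclosed_compact cL _.
apply/seteqP; split=> // l [[Al dl] bl]; have /= ly := Ab l (conj Al bl).
by move: dl; rewrite ly /= /dn mdistxx mulr0 ler10.
Qed.

(** Here L^(b) is finite. The space [L] is cut into closed pieces with one point of L^(b) each, and
    these are covered inside disjoint neighbourhoods of distinct points of K^(b). *)
Lemma closed_surjection_of_scattered b (l0 : L) : cb_deriv L (osucc b) = set0 ->
  cb_deriv L b !=set0 -> (cb_deriv L b #<= cb_deriv K b)%card ->
  exists (F : set K) (phi : K -> L),
    [/\ closed F, {within F, continuous phi} & phi @` F = [set: L]].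
Proof.
move=> Sb0 [y0 by0] /card_leP[f].
have fin : finite_set (cb_deriv L b).
  by apply: finite_no_derived => //; exact: cb_deriv_closed.
have [X XE] := finite_fsetP.1 fin.
have bX (i : X) : cb_deriv L b (val i) by rewrite XE /=; exact: valP.
have [V [nV dV]] := separate_finite hL (@val_inj _ _ X).
pose g (i : X) : K := val (f (SigSub (mem_set (bX i)))).
have g_inj : injective g.
  move=> i j /val_inj gij; apply: val_inj.
  by have /(congr1 val) := inj (mem_set I) (mem_set I) gij.
have [W [nW dW]] := separate_finite hK g_inj.
(* Leaving out the interiors of the other [V j] makes [A i] closed; as the [V j] are disjoint, every
   point stays in some [A i]. *)
pose A (i : X) : set L := [set l | forall j, (V j)° l -> j = i].
have clA i : closed (A i).
  rewrite -openC openE => l /existsNP[j /not_implyP[Vjl ji]].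
  rewrite /interior; apply: filterS (nbhs_interior Vjl) => u Vju /(_ j Vju).
  exact: ji.
have GP i : exists G, covers G (W i) (A i).
  apply: (@covers_of_rank b (g i) _ _ (val i)) => //.
    exact: set_valP.
  move=> l [Al]; rewrite {1}XE /= => lX.
  have -> : l = val (FSetSub lX) by [].
  by rewrite (Al (FSetSub lX) (nV (FSetSub lX))).
have [G GE] := choice GP.
apply: (@continuous_of_closed_relation _ _ (\bigcup_(i in [set: X]) G i) l0 cL).
- by apply: closed_bigcup => [|i _]; [exact: finite_finset|case: (GE i)].
- move=> z l l' [i _ Gil] [j _ Gjl'].
  have [_ _ /(_ _ _ Gil) Wi _] := GE i; have [_ _ /(_ _ _ Gjl') Wj _] := GE j.
  have ij := dW _ _ _ Wi Wj; rewrite -ij in Gjl'.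
  by have [_ fG _ _] := GE i; exact: fG Gil Gjl'.
- move=> l; have [i Ail] : exists i, A i l.
    have [[i Vi]|nV'] := pselect (exists i, (V i)° l).
      by exists i => j Vj; exact: dV (interior_subset Vj) (interior_subset Vi).
    have y0X : y0 \in X by move: by0; rewrite XE.
    by exists (FSetSub y0X) => j Vj; case: nV'; exists j.
  by have [_ _ _ /(_ l Ail)[z Gz]] := GE i; exists z, i.
Qed.

End Realization.

(** * Nonscattered spaces *)

Section CantorScheme.
Variables (K : topologicalType) (P : set K).
Hypothesis cK : compact [set: K].
Hypothesis hK : hausdorff_space K.
Hypothesis P0 : P !=set0.
Hypothesis dP : derived P = P.

Lemma perfect_split (k : K) (W : set K) : P k -> nbhs k W ->
  exists k1 k2 W1 W2, [/\ P k1 /\ P k2, nbhs k1 W1 /\ nbhs k2 W2,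
    W1 `<=` W /\ W2 `<=` W & closure W1 `&` closure W2 = set0].
Proof.
rewrite -{1}dP => -[Pk lk] kW.
have [k' [k'k Pk' Wk']] := lk W° (nbhs_interior kW).
have := hK; rewrite open_hausdorff => /(_ _ _ k'k)[[U1 U2] /=].
move=> [/set_mem U1k' /set_mem U2k] [oU1 oU2 /eqP U12].
have [V1 kV1 VU1] := @compact_regular K k' setT hK cK filterT U1
  (open_nbhs_nbhs (conj oU1 U1k')).
have [V2 kV2 VU2] := @compact_regular K k setT hK cK filterT U2
  (open_nbhs_nbhs (conj oU2 U2k)).
exists k', k, (V1 `&` W), (V2 `&` W); split=> //.
- by split; apply: filterI.
- apply/seteqP; split=> // x [c1 c2].
  have <- : U1 `&` U2 = set0 by []; split.
    by apply: VU1; apply: closureS c1 => u [].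
  by apply: VU2; apply: closureS c2 => u [].
Qed.

Lemma cantor_relation : exists G : set (K * cantor_space),
  [/\ closed G, functional G & forall b, exists z, G (z, b)].
Proof.
have splitP (s : K * set K) : exists t : bool -> K * set K,
    P s.1 -> nbhs s.1 s.2 -> (forall i, [/\ P (t i).1, nbhs (t i).1 (t i).2 &
      (t i).2 `<=` s.2]) /\ closure (t true).2 `&` closure (t false).2 = set0.
  case: s => k W; have [[Pk kW]|n] := pselect (P k /\ nbhs k W); last first.
    by exists (fun=> (k, W)) => Pk kW; case: n.
  have [k1 [k2 [W1 [W2 [[Pk1 Pk2] [kW1 kW2] [W1W W2W] W12]]]]] := perfect_split
    Pk kW.
  by exists (fun i => if i then (k1, W1) else (k2, W2)) => _ _; split=> // -[].
have [t tP] := choice splitP.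
have [k0 Pk0] := P0.
(* Node [n] of branch [b] is a point of [P] with a neighbourhood; the neighbourhoods at its two
   children have disjoint closures. *)
pose w := fix w (b : nat -> bool) n :=
  if n is m.+1 then t (w b m) (b m) else (k0, setT).
have wP b n : P (w b n).1 /\ nbhs (w b n).1 (w b n).2.
  elim: n => [|n [Pn kn]]; first by split=> //; exact: filterT.
  by have [/(_ (b n))[]] := tP (w b n) Pn kn.
have wS b n : (w b n.+1).2 `<=` (w b n).2.
  by have [Pn kn] := wP b n; have [/(_ (b n))[]] := tP (w b n) Pn kn.
have wmono b m n : (m <= n)%N -> (w b n).2 `<=` (w b m).2.
  move=> /subnKC <-; elim: (n - m)%N => [|i IHi]; first by rewrite addn0.
  by rewrite addnS; exact: subset_trans (wS _ _) IHi.
(* Node [n] depends on the first [n] bits only, so being outside [closure (w b n).2] is an open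
   condition on the pair. *)
have weq (b b' : nat -> bool) n : (forall m, (m < n)%N -> b m = b' m) -> w b n
  = w b' n.
  elim: n => // n IHn bb' /=; rewrite bb'// IHn// => m mn; apply: bb'.
  exact: ltnW.
exists [set p | forall n, closure (w p.2 n).2 p.1]; split.
- rewrite -openC openE => -[z b] /existsNP[n nz].
  pose V := [set b' : cantor_space | forall m : 'I_n, b' m = b m].
  have bV : nbhs b V.
    apply: (@filter_forall cantor_space _
      (fun (m : 'I_n) (b' : cantor_space) => b' m = b m) (nbhs b) _) => m.
    have := @proj_continuous nat (fun=> bool) m b [set b m].
    by apply; exact: discrete_set1.
  exists (~` closure (w b n).2, V).
    split=> //=; apply: open_nbhs_nbhs; split=> //.
    exact/closed_openC/closed_closure.
  move=> [z' b'] [/= nz' Vb'] /(_ n) /=; rewrite (@weq b' b)// => m mn.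
  exact: (Vb' (Ordinal mn)).
- move=> z b b' /= zb zb'; apply: contrapT => bb'.
  have ex : exists n, b n != b' n.
    apply: contrapT => nb; apply: bb'; apply/funext => n.
    by apply: contrapT => /eqP bn; apply: nb; exists n.
  case: (ex_minnP ex) => n bn nmin.
  have wn : w b' n = w b n.
    apply: weq => m mn; apply/eqP/negPn/negP; rewrite eq_sym => /nmin.
    by rewrite leqNgt mn.
  have [Pn kn] := wP b n; have [_ dis] := tP (w b n) Pn kn.
  have := zb n.+1; have := zb' n.+1; rewrite /= wn.
  suff H (i : bool) : i != ~~ i -> closure (t (w b n) i).2 z ->
      closure (t (w b n) (~~ i)).2 z -> False.
    have -> : b' n = ~~ b n by move: bn; case: (b n); case: (b' n).
    by move=> ? ?; apply: (H (b n)) => //; case: (b n).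
  case: i => _ h1 h2.
    by have : (closure (t (w b n) true).2 `&` closure (t (w b n) false).2) z by
      [];
       rewrite dis.
  by have : (closure (t (w b n) true).2 `&` closure (t (w b n) false).2) z by
    [];
     rewrite dis.
- move=> b; have [||||z Hz] := @compact_directed_meet K nat
    (fun n => closure (w b n).2) cK.
  + exact: (inhabits 0%N).
  + by move=> n; exact: closed_closure.
  + move=> n; exists (w b n).1; apply: subset_closure.
    by have [_ ?] := wP b n; exact: nbhs_singleton.
  + by move=> i j; exists (maxn i j); split; apply: closureS; apply: wmono;
      rewrite ?leq_maxl ?leq_maxr.
  by exists z.
Qed.

End CantorScheme.

Lemma closed_surjection_of_nonscattered (R : realType) (L : metricType R)
    (K : topologicalType) (l0 : L) : compact [set: L] ->
  compact [set: K] -> hausdorff_space K -> ~ scattered K ->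
  exists (F : set K) (phi : K -> L),
    [/\ closed F, {within F, continuous phi} & phi @` F = [set: L]].
Proof.
move=> cL cK hK /perfect_kernel_nonempty[P [P0 dP _]].
have [G [clG fG sG]] := cantor_relation cK hK P0 dP.
have [F [psi [clF cpsi spsi]]] := continuous_of_closed_relation
  (point : cantor_space) cantor_space_compact clG fG sG.
pose T := HB.pack_for (pseudoPMetricType R) L (isPointed.Build L l0).
have [f cf] := @cantor_surj R T cL (@metric_hausdorff R L).
exists F, (f \o psi); split=> //.
  move=> x; apply: (@continuous_comp (subspace F) cantor_space T psi f).
    exact: cpsi.
  exact: cf.
apply/seteqP; split=> // l _; have [b _ <-] := @surj _ _ _ _ f l I.
have : (psi @` F) b by rewrite spsi.
by move=> [z Fz <-]; exists z.
Qed.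

(** * Isometries into strictly convex spaces *)

Section CspaceFacts.
Context {R : realType} {K : topologicalType} (cK : compact [set: K]).
Context {E : normedModType R}.
Implicit Types f g : Cspace cK E.

Lemma CspaceDE f g x : (f + g) x = f x + g x.
Proof. by []. Qed.

Lemma CspaceNE f x : (- f) x = - f x.
Proof. by []. Qed.

Lemma CspaceZE (a : R) f x : (a *: f) x = a *: f x.
Proof. by []. Qed.

Lemma Cspace_sumE (I : Type) (r : seq I) (P : pred I) (F : I -> Cspace cK E) x :
  (\sum_(i <- r | P i) F i) x = \sum_(i <- r | P i) F i x.
Proof. by elim/big_rec2: _ => // i a b _ <-. Qed.

Lemma Cspace_norm_le f (M : R) : 0 <= M -> (forall x, `|f x| <= M) -> `|f| <= M.
Proof. exact: sup_norm_le. Qed.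

Lemma le_Cspace_norm f x : `|f x| <= `|f|.
Proof. exact: le_sup_norm. Qed.

Lemma Cspace_norm_attained f : [set: K] !=set0 -> exists x, `|f x| = `|f|.
Proof.
move=> K0; have cnf : continuous (fun x => `|f x|).
  by move=> x; apply: cvg_norm; exact: (@Cspace_cts).
have [x _ xmax] := compact_EVT_max K0 cK (continuous_subspaceT cnf).
exists x; apply/eqP; rewrite eq_le le_Cspace_norm/= Cspace_norm_le// => y.
by apply: xmax; exact: mem_set.
Qed.

Definition Ccst (e : E) : Cspace cK E := @cfun _ _ cK _ (fun=> e)
  (@cst_continuous _ _ e).

End CspaceFacts.

Section Holsztynski.
Context {R : realType} {L : metricType R} {K : topologicalType}.
Context {E : normedModType R}.
Variables (cL : compact [set: L]) (cK : compact [set: K]).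
Hypothesis K0 : [set: K] !=set0.
Hypothesis E_strict : strictly_convex E.
Variable T : {linear Cspace cL R -> Cspace cK E}.
Hypothesis Tiso : isometric T.

Let one : Cspace cL R := Ccst cL (1 : R).

Let peak (y : L) (f : Cspace cL R) := f y = 1 /\ forall x, `|f x| <= 1.

Let peak_norm y f : peak y f -> `|f| = 1.
Proof.
move=> [fy f1]; apply/eqP; rewrite eq_le Cspace_norm_le//=.
by have := le_Cspace_norm f y; rewrite fy normr1.
Qed.

Let peakT y f k : peak y f -> `|T f k| <= 1.
Proof. by move=> /peak_norm f1; rewrite -f1 -Tiso; exact: le_Cspace_norm. Qed.

Let mid f g : Cspace cL R := 2^-1 *: (f + g).

Let peak_mid y f g : peak y f -> peak y g -> peak y (mid f g).
Proof.
move=> [fy f1] [gy g1]; split=> [|x].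
  by rewrite /mid CspaceZE CspaceDE fy gy; apply: mulVf.
rewrite /mid CspaceZE CspaceDE normrZ.
have := ler_normD (f x) (g x); have := f1 x; have := g1 x.
rewrite ger0_norm ?invr_ge0//; lra.
Qed.

Let T_mid f g k : T (mid f g) k = 2^-1 *: (T f k + T g k).
Proof. by rewrite /mid linearZ linearD. Qed.

(** Where [T (mid f g)] has norm 1, so have [T f] and [T g]; thus the closed sets [C f] are directed
    and have a common point [k]. There the midpoint of [T f k] and [T one k] has norm 1, so they
    agree by strict convexity. *)
Lemma peak_point y : exists k, 1 <= `|T one k| /\
  forall f, peak y f -> T f k = T one k.
Proof.
have peak1 : peak y one by split=> // x; rewrite /= normr1.
pose C (f : {f | peak y f}) := [set k | 1 <= `|T (sval f) k|].
have [||||k Hk] := @compact_directed_meet K _ C cK.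
- exact: (inhabits (exist _ one peak1)).
- move=> f; apply: (@preimage_closed _ _ (fun k =>
    `|T (sval f) k|) [set x | 1 <= x]).
    by move=> k _; apply: cvg_norm; exact: (@Cspace_cts).
  exact: closed_ge.
- move=> f; have [k fk] := Cspace_norm_attained (T (sval f)) K0.
  by exists k; rewrite /C /= fk Tiso (peak_norm (svalP f)).
- move=> [f pf] [g pg]; exists (exist _ (mid f g) (peak_mid pf pg)).
  have fg k : 1 <= `|T (mid f g) k| -> 1 <= `|T f k| /\ 1 <= `|T g k|.
    rewrite T_mid normrZ ger0_norm ?invr_ge0//.
    have := ler_normD (T f k) (T g k); have := peakT k pf; have := peakT k pg;
      lra.
  by split=> k /= /fg[].
have nk f : peak y f -> `|T f k| = 1.
  by move=> pf; apply/eqP; rewrite eq_le (peakT k pf)/=;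
    exact: (Hk (exist _ f pf)).
exists k; split=> [|f pf]; first by rewrite nk.
apply/eqP; apply: contrapT => /negP fk.
have := E_strict (nk f pf) (nk one peak1) fk.
by rewrite -T_mid nk ?ltxx//; exact: peak_mid.
Qed.

Lemma peak_point_eval y : exists k, 1 <= `|T one k| /\
  forall f, T f k = f y *: T one k.
Proof.
have [k [k1 kf]] := peak_point y; exists k; split=> // f.
suff H (h : Cspace cL R) : h y = 0 -> T h k = 0.
  have : T (f - f y *: one) k = 0.
    by apply: H; rewrite CspaceDE CspaceNE CspaceZE /= [_ *: _]mulr1 subrr.
  by rewrite linearB linearZ CspaceDE CspaceNE CspaceZE => /eqP;
    rewrite subr_eq0 => /eqP.
move=> {f} hy; wlog h1 : h hy / forall x, `|h x| <= 1.
  move=> H; pose c := `|h| + 1; have c0 : 0 < c by rewrite ltr_wpDl.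
  have := H (c^-1 *: h); rewrite linearZ !CspaceZE hy => /(_ (scaler0 _ _)).
  have hc x : `|(c^-1 *: h) x| <= 1.
    rewrite CspaceZE normrZ normfV (gtr0_norm c0) mulrC ler_pdivrMr// mul1r.
    by apply: le_trans (le_Cspace_norm h x) _; rewrite lerDl.
  move=> /(_ hc)/eqP; rewrite scaler_eq0 invr_eq0 (gt_eqF c0)/=.
  by move/eqP.
have cg : continuous (fun x => 1 - `|h x|).
  move=> x; apply: cvgB; first exact: cvg_cst.
  by apply: cvg_norm; exact: (@Cspace_cts).
pose g : Cspace cL R := cfun cg.
have gE x : g x = 1 - `|h x| by [].
have pg : peak y g.
  split=> [|x]; first by rewrite gE hy normr0 subr0.
  by rewrite gE ger0_norm ?subr_ge0 ?h1//.
have pgh : peak y (g + h).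
  split=> [|x]; first by rewrite CspaceDE hy addr0; case: pg.
  by rewrite CspaceDE gE ler_norml; have := h1 x; case: (ler0P (h x)); lra.
have := kf _ pgh; rewrite linearD CspaceDE (kf _ pg).
by move/eqP; rewrite addrC -subr_eq0 addrK => /eqP.
Qed.

Lemma closed_surjection_of_isometry (l0 : L) :
  exists (F : set K) (phi : K -> L),
    [/\ closed F, {within F, continuous phi} & phi @` F = [set: L]].
Proof.
(* The lower bound is a closed condition that keeps [T one] away from 0, so that [T f p.1]
   determines [f p.2]. *)
pose G := [set p : K * L | 1 <= `|T one p.1| /\ forall f, T f p.1 = f p.2 *: T
  one p.1].
apply: (@continuous_of_closed_relation _ _ G l0 cL).
- rewrite (_ : G = [set p | 1 <= `|T one p.1|] `&`
      \bigcap_(f in [set: Cspace cL R]) [set p | T f p.1 - f p.2 *: T one p.1 =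
        0]).
    apply: closedI.
      apply: (@preimage_closed _ _ (fun p : K * L =>
        `|T one p.1|) [set x | 1 <= x]).
        move=> p _; apply: cvg_norm.
        apply: (@continuous_comp _ _ _ (fst : K * L -> K) (T one));
          first exact: cvg_fst.
        exact: (@Cspace_cts).
      exact: closed_ge.
    apply: closed_bigI => f _.
    apply: (@preimage_closed _ _ (fun p : K * L =>
      T f p.1 - f p.2 *: T one p.1) [set x | x = 0]).
      move=> p _; apply: cvgB.
        apply: (@continuous_comp _ _ _ (fst : K * L -> K) (T f));
          first exact: cvg_fst.
        exact: (@Cspace_cts).
      apply: cvgZ.
        apply: (@continuous_comp _ _ _ (snd : K * L -> L) f);
          first exact: cvg_snd.
        exact: (@Cspace_cts).
      apply: (@continuous_comp _ _ _ (fst : K * L -> K) (T one));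
        first exact: cvg_fst.
      exact: (@Cspace_cts).
    exact/accessible_closed_set1/hausdorff_accessible/norm_hausdorff.
  apply/seteqP; split=> -[k l] /= [k1 kf]; split=> //.
    by move=> f _; rewrite /= kf subrr.
  by move=> f; apply/eqP; rewrite -subr_eq0; apply/eqP; exact: kf.
- move=> k l l' [/= k1 kl] [_ /= kl'].
  (* All functions agree at two points paired with the same [k]; the distance from [l] then vanishes
     at [l']. *)
  pose d : Cspace cL R := cfun (@continuous_mdist _ _ l).
  have dE x : d x = mdist l x by [].
  have := kl d; rewrite (kl' d) !dE mdistxx scale0r => /eqP.
  have Tk0 : T one k != 0 by rewrite -normr_gt0; exact: lt_le_trans ltr01 k1.
  by rewrite scaler_eq0 (negbTE Tk0) orbF => /eqP/mdist_positivity.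
- by move=> l; have [k kP] := peak_point_eval l; exists k.
Qed.

End Holsztynski.

(** * Positive extension operators *)

Section WeightedSums.
Context {R : realType}.
Implicit Types (u v : nat -> R) (C : R).

(** The weights add up to 2, hence the factors 2 in the estimates below. *)
Definition wsum u : R := limn (series (fun n => 2^-1 ^+ n * u n)).

Definition bounded_by C u := forall n, `|u n| <= C.

Let half_lt1 : `|2^-1| < 1 :> R.
Proof. by rewrite ger0_norm ?invr_ge0// invf_lt1// ltr1n. Qed.

Let q_ge0 n : 0 <= 2^-1 ^+ n :> R.
Proof. by rewrite exprn_ge0. Qed.

Lemma wsum_cvg C u : bounded_by C u -> cvgn (series (fun n => 2^-1 ^+ n * u n)).
Proof.
move=> uC; have C0 : 0 <= C := le_trans (normr_ge0 _) (uC 0%N).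
apply: (@normed_cvg R R); apply: (@series_le_cvg R _ (geometric C 2^-1)) =>
  [n|n|n|].
- exact: normr_ge0.
- by rewrite mulr_ge0.
- by rewrite /= normrM (ger0_norm (q_ge0 n)) mulrC ler_wpM2r.
- exact: is_cvg_geometric_series.
Qed.

Lemma wsumD C u C' v : bounded_by C u -> bounded_by C' v ->
  wsum (fun n => u n + v n) = wsum u + wsum v.
Proof.
move=> uC vC; rewrite /wsum -lim_seriesD;
  [|exact: wsum_cvg uC|exact: wsum_cvg vC].
by congr (limn (series _)); apply/funext => n; rewrite mulrDr.
Qed.

Lemma wsumZ C u a : bounded_by C u -> wsum (fun n => a * u n) = a * wsum u.
Proof.
move=> uC; have := lim_seriesZ a (wsum_cvg uC); rewrite /GRing.scale/= => <-.
by congr (limn (series _)); apply/funext => n; rewrite mulrCA.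
Qed.

Lemma wsum_le C u C' v : bounded_by C u -> bounded_by C' v ->
  (forall n, u n <= v n) -> wsum u <= wsum v.
Proof.
move=> uC vC uv; apply: lim_series_le => [||n].
- exact: wsum_cvg uC.
- exact: wsum_cvg vC.
- by rewrite ler_wpM2l.
Qed.

Lemma wsum0 : wsum (fun=> 0) = 0.
Proof.
have b0 : bounded_by 0 (fun=> 0 : R) by move=> n; rewrite normr0.
by have := wsumZ 0 b0; rewrite !mul0r.
Qed.

Lemma wsum_ge0 C u : bounded_by C u -> (forall n, 0 <= u n) -> 0 <= wsum u.
Proof.
by move=> uC u0; rewrite -wsum0; apply: (@wsum_le 0 _ C) => // n;
  rewrite normr0.
Qed.

Lemma wsum_norm C u : bounded_by C u -> `|wsum u| <= wsum (fun n => `|u n|).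
Proof.
move=> uC; have nuC : bounded_by C (fun n => `|u n|).
  by move=> n; rewrite normr_id.
have NuC : bounded_by C (fun n => -1 * u n).
  by move=> n; rewrite mulN1r normrN.
rewrite ler_norml lerNl -mulN1r -(wsumZ _ uC); apply/andP; split.
  by apply: (wsum_le NuC nuC) => n; rewrite mulN1r -normrN ler_norm.
by apply: (wsum_le uC nuC) => n; exact: ler_norm.
Qed.

Lemma wsum_recl C u : bounded_by C u ->
  wsum u = u 0%N + 2^-1 * wsum (fun n => u n.+1).
Proof.
move=> uC; have uC' : bounded_by C (fun n => u n.+1) by move=> n; exact: uC.
apply/cvg_lim => //; rewrite -cvg_shiftS /=.
have -> : (fun n => series (fun n => 2^-1 ^+ n * u n) n.+1) =
    (fun n => u 0%N + 2^-1 * series (fun n => 2^-1 ^+ n * u n.+1) n).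
  apply/funext => n; rewrite /series /= big_nat_recl// expr0 mul1r mulr_sumr.
  by congr (_ + _); apply: eq_bigr => i _; rewrite exprS mulrA.
apply: cvgD; first exact: cvg_cst.
apply: cvgM; first exact: cvg_cst.
exact: wsum_cvg uC'.
Qed.

Lemma wsum_le2 C u : bounded_by C u -> wsum u <= 2 * C.
Proof.
move=> uC; have cC : bounded_by `|C| (fun=> C) by [].
have -> : 2 * C = wsum (fun=> C).
  (* For a constant sequence the sum [s] satisfies [s = C + s / 2]. *)
  have := wsum_recl cC; lra.
by apply: (wsum_le uC cC) => n; exact: le_trans (ler_norm _) (uC n).
Qed.

Lemma wsum_norm_le2 C u : bounded_by C u -> `|wsum u| <= 2 * C.
Proof.
move=> uC; apply: le_trans (wsum_norm uC) _; apply: wsum_le2 => n.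
by rewrite normr_id.
Qed.

Lemma wsum_ge_term C u n : bounded_by C u -> (forall n, 0 <= u n) ->
  2^-1 ^+ n * u n <= wsum u.
Proof.
elim: n u => [|n IHn] u uC u0; have uC' : bounded_by C (fun n => u n.+1)
  by move=> i; exact: uC.
  rewrite (wsum_recl uC) expr0 mul1r lerDl mulr_ge0 ?invr_ge0//.
  exact: (wsum_ge0 uC').
rewrite (wsum_recl uC) exprS -mulrA; apply: ler_wpDl => //.
by rewrite ler_wpM2l ?invr_ge0//; exact: IHn.
Qed.

Lemma wsum_tail C u N : bounded_by C u ->
  `|wsum u| <= \sum_(i < N) `|u i| + 2^-1 ^+ N * (2 * C).
Proof.
elim: N u => [|N IHN] u uC.
  by rewrite big_ord0 add0r expr0 mul1r; exact: wsum_norm_le2.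
have uC' : bounded_by C (fun n => u n.+1) by move=> i; exact: uC.
rewrite (wsum_recl uC) big_ord_recl/= exprS; apply: le_trans (ler_normD _ _) _.
rewrite normrM (ger0_norm (_ : 0 <= 2^-1)) ?invr_ge0//.
have := IHN _ uC'; rewrite /bump /=.
set s := \sum_(i < N) _ => IH.
have s0 : 0 <= s by rewrite sumr_ge0.
by rewrite -addrA lerD2l -mulrA; lra.
Qed.

(** The bound of [wsum_tail] is uniform in [x], so only finitely many coordinates have to be
    controlled near a point. *)
Lemma wsum_continuous (X : topologicalType) C (u : X -> nat -> R) :
  (forall n, continuous (u^~ n)) -> (forall x, bounded_by C (u x)) ->
  continuous (fun x => wsum (u x)).
Proof.
move=> cu uC x; apply/cvgrPdist_lt => e e0.
have C0 : 0 <= C := le_trans (normr_ge0 _) (uC x 0%N).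
pose d y n := u x n - u y n.
have dC y : bounded_by (C + C) (d y).
  by move=> n; apply: le_trans (ler_normB _ _) _; apply: lerD; exact: uC.
have [N qN] : exists N, 2^-1 ^+ N * (2 * (C + C)) < e / 2.
  have := @cvg_geometric R (2 * (C + C)) 2^-1 half_lt1.
  move=> /cvgr0Pnorm_lt/(_ (e / 2)); rewrite divr_gt0// =>
    /(_ isT)[N _ /(_ N (leqnn N))].
  by rewrite /= ger0_norm => [?|]; [exists N;
    rewrite mulrC|rewrite !mulr_ge0// addr_ge0].
have nearN : \forall y \near x, forall i : 'I_N, `|d y i| < e / 2 / N.+1%:R.
  apply: filter_forall => i; have /cvgrPdist_lt := cu i x; apply.
  by rewrite !divr_gt0.
apply: filterS nearN => y dy.
have -> : wsum (u x) - wsum (u y) = wsum (d y).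
  rewrite -mulN1r -(wsumZ _ (uC y)) -(wsumD (uC x) (C' := C)).
    by congr wsum; apply/funext => n; rewrite mulN1r.
  by move=> n; rewrite mulN1r normrN; exact: uC.
apply: le_lt_trans (wsum_tail N (dC y)) _; rewrite [ltRHS]splitr ler_ltD//.
apply: (@le_trans _ _ (\sum_(i < N) (e / 2 / N.+1%:R))).
  by apply: ler_sum => i _; exact/ltW/dy.
rewrite sumr_const card_ord -[_ *+ N]mulr_natr -mulrA ler_piMr//.
  by rewrite divr_ge0// ltW.
by rewrite ler_pdivrMl// mulr1 ler_nat.
Qed.

End WeightedSums.

Lemma dense_sequence (R : realType) (L : metricType R) (l0 : L) :
  compact [set: L] -> exists x : nat -> L,
    forall (l : L) (e : R), 0 < e -> exists n, mdist (x n) l < e.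
Proof.
move=> cL; have netP (n : nat) : exists s : seq L,
    forall l : L, exists2 y, y \in s & mdist y l < n.+1%:R^-1 :> R.
  have := @compact_set_ind L setT (fun U => exists s : seq L,
    forall l, U l -> exists2 y, y \in s & mdist y l < n.+1%:R^-1 :> R) cL.
  case=> [|U V UV [s sV]|U V [s sU] [t tV]|l _|s sP].
  - by exists [::].
  - by exists s => l /UV; exact: sV.
  - exists (s ++ t) => l [/sU|/tV] [y ys yl]; exists y => //.
      by rewrite mem_cat ys.
    by rewrite mem_cat ys orbT.
  - exists (ball l (n.+1%:R^-1)); first by apply: nbhsx_ballx; rewrite invr_gt0.
    by exists [:: l] => l'; rewrite ballEmdist /= => ll'; exists l;
      rewrite ?mem_head.
  - by exists s => l; exact: sP.
have [s sP] := choice netP.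
exists (fun m => if @choice.unpickle (nat * nat)%type m is Some (n, i) then nth
  l0 (s n) i else l0).
move=> l e e0.
have [n ne] : exists n, n.+1%:R^-1 < e.
  exists (Num.trunc e^-1); rewrite invf_plt ?posrE//; exact: truncnS_gt.
have [y ys yl] := sP n l.
exists (choice.pickle (n, index y (s n))); rewrite choice.pickleK nth_index//.
exact: lt_trans yl ne.
Qed.

(** * Extension from [F] to [K] by averaging over a dense sequence *)

Section ExtensionOperator.
Context {R : realType} {L : metricType R} {K : topologicalType}.
Variables (cL : compact [set: L]) (cK : compact [set: K]).
Hypothesis hK : hausdorff_space K.
Variables (F : set K) (phi : K -> L).
Hypothesis clF : closed F.
Hypothesis cphi : {within F, continuous phi}.
Hypothesis sphi : phi @` F = [set: L].
Variable l0 : L.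

Lemma mdist_bounded : exists2 C : R, 0 < C & forall l l' : L, mdist l l' <= C.
Proof.
have [] := @compact_EVT_max L R (mdist l0) setT _ cL.
- by exists l0.
- exact: continuous_subspaceT (@continuous_mdist _ _ l0).
move=> c _ cmax; exists (2 * mdist l0 c + 1);
  first by rewrite ltr_wpDl// mulr_ge0// mdist_ge0.
move=> l l'; have := metric_triangle l l0 l'; rewrite (metric_sym l l0).
have := cmax l (mem_set I); have := cmax l' (mem_set I); lra.
Qed.

Lemma dist_extension : exists (C : R) (x : nat -> L) (G : nat -> K -> R),
  [/\ (forall (l : L) (e : R), 0 < e -> exists n, mdist (x n) l < e),
      (forall l l' : L, mdist l l' <= C),
      (forall n, continuous (G n)), (forall n z, `|G n z| <= C) &
      forall n z, F z -> G n z = mdist (x n) (phi z)].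
Proof.
have [C C0 dC] := mdist_bounded; have [x xP] := dense_sequence l0 cL.
have GP n : exists g : K -> R, [/\ continuous g, forall z, `|g z| <= C &
    forall z, F z -> g z = mdist (x n) (phi z)].
  have [|||g [gE cg gC]] := @continuous_bounded_extension K R _ F clF
      (fun z => mdist (x n) (phi z)) C C0.
  - exact: compact_normal.
  - move=> z; apply: (@continuous_comp (subspace F) L R phi (mdist (x n))).
      exact: cphi.
    exact: continuous_mdist.
  - by move=> z _; rewrite ger0_norm ?mdist_ge0.
  by exists g; split=> // z Fz; rewrite gE//; exact: mem_set.
have [G GE] := choice GP.
by exists C, x, G; split=> // n; case: (GE n).
Qed.

Section Averages.
Variables (C : R) (x : nat -> L) (G : nat -> K -> R).
Hypothesis xP : forall (l : L) (e : R), 0 < e -> exists n, mdist (x n) l < e.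
Hypothesis dC : forall l l' : L, mdist l l' <= C.
Hypothesis cG : forall n, continuous (G n).
Hypothesis GC : forall n z, `|G n z| <= C.
Hypothesis GF : forall n z, F z -> G n z = mdist (x n) (phi z).
Implicit Types (z : K) (l : L) (f : Cspace cL R).

Let u z l n : R := `|G n z - mdist (x n) l|.
Let D z l := wsum (u z l).
(** A pseudometric on [K] for which [D] and [m] are 1-Lipschitz in [z]. *)
Let e z z' := wsum (fun n => `|G n z - G n z'|).
Let m z := inf (range (D z)).

Let uC z l : bounded_by (C + C) (u z l).
Proof.
move=> n; rewrite normr_id; apply: le_trans (ler_normB _ _) _.
by apply: lerD => //; rewrite ger0_norm ?mdist_ge0.
Qed.

Let eC z z' : bounded_by (C + C) (fun n => `|G n z - G n z'|).
Proof. by move=> n; rewrite normr_id; apply: le_trans (ler_normB _ _) _;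
  exact: lerD. Qed.

Let D_ge0 z l : 0 <= D z l. Proof. by apply: (wsum_ge0 (@uC z l)) => n;
  exact: normr_ge0. Qed.

Let D_le_e z z' l : D z l <= D z' l + e z z'.
Proof.
rewrite /D /e -(wsumD (@uC z' l) (@eC z z')).
apply: (wsum_le (@uC z l) (C' := C + C + (C + C))) => n.
  by apply: le_trans (ler_normD _ _) _; apply: lerD; [exact: uC|exact: eC].
by rewrite /u [leRHS]addrC; apply: le_trans (ler_normD _ _);
  rewrite addrA subrK.
Qed.

Let D_le_dist z l l' : D z l <= D z l' + 2 * mdist l l'.
Proof.
have cd : bounded_by (mdist l l') (fun=> mdist l l' : R).
  by move=> n; rewrite ger0_norm ?mdist_ge0.
have -> : 2 * mdist l l' = wsum (fun=> mdist l l' : R) by have := wsum_recl cd;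
  lra.
rewrite /D -(wsumD (@uC z l') cd).
apply: (wsum_le (@uC z l) (C' := C + C + mdist l l')) => n.
  by apply: le_trans (ler_normD _ _) _; apply: lerD; [exact: uC|exact: cd].
have := mdist_lip (x n) l l'; rewrite distrC => /(lerD (lexx (u z l' n))).
by apply: le_trans; rewrite /u; apply: le_trans (ler_normD _ _);
  rewrite addrA subrK.
Qed.

Let D_continuous z : continuous (D z).
Proof.
apply: (@wsum_continuous R L (C + C) (u z)) => [n l|l]; last exact: uC.
apply: cvg_norm; apply: cvgB; first exact: cvg_cst.
exact: continuous_mdist.
Qed.

Let D_continuousl l : continuous (D^~ l).
Proof.
apply: (@wsum_continuous R K (C + C) (fun z => u z l)) => [n z|z];
  last exact: uC.
apply: cvg_norm; apply: cvgB; first exact: cG.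
exact: cvg_cst.
Qed.

Let e_continuous z : continuous (e z).
Proof.
apply: (@wsum_continuous R K (C + C) (fun z' n => `|G n z - G n z'|)) =>
  [n z'|z'].
  apply: cvg_norm; apply: cvgB; first exact: cvg_cst.
  exact: cG.
exact: eC.
Qed.

Let ezz z : e z z = 0.
Proof.
by rewrite /e -[RHS]wsum0; congr wsum; apply/funext => n; rewrite subrr normr0.
Qed.

Let e_sym z z' : e z z' = e z' z.
Proof. by rewrite /e; congr wsum; apply/funext => n; rewrite distrC. Qed.

(** A zero [l] of [D z] has the prescribed distances [G n z] to all [x n], and these determine [l]
    by density. *)
Let D_inj z l l' : D z l = 0 -> D z l' = 0 -> l = l'.
Proof.
have D0 y n : D z y = 0 -> G n z = mdist (x n) y.
  move=> Dy; have := wsum_ge_term n (@uC z y) (fun n => normr_ge0 _).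
  rewrite -/(D z y) Dy pmulr_rle0 ?exprn_gt0 ?invr_gt0// normr_le0 subr_eq0.
  by move/eqP.
move=> Dl Dl'; apply: mdist_positivity; apply/eqP.
rewrite eq_le mdist_ge0 andbT; apply/ler_addgt0Pl => r r0; rewrite addr0.
have [n nl] := xP l (divr_gt0 r0 (ltr0Sn _ 1)).
have := metric_triangle l (x n) l'; rewrite -(D0 l' n Dl') (D0 l n Dl).
rewrite (metric_sym l (x n)); lra.
Qed.

Let D_phi z : F z -> D z (phi z) = 0.
Proof.
move=> Fz; rewrite /D -[RHS]wsum0; congr wsum; apply/funext => n.
by rewrite /u GF// subrr normr0.
Qed.

Let hasD z : has_inf (range (D z)).
Proof. by split; [exists (D z l0), l0|exists 0 => _ [l _ <-];
  exact: D_ge0]. Qed.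

Let m_le z l : m z <= D z l.
Proof. by apply: ge_inf; [case: (hasD z)|exists l]. Qed.

Let m_ge0 z : 0 <= m z.
Proof. by apply: lb_le_inf; [case: (hasD z)|move=> _ [l _ <-];
  exact: D_ge0]. Qed.

Let m_adherent z r : 0 < r -> exists l, D z l < m z + r.
Proof. by move=> r0; have [_ [l _ <-] lr] := inf_adherent r0 (hasD z);
  exists l. Qed.

Let m_le_e z z' : m z <= m z' + e z z'.
Proof.
apply/ler_addgt0Pl => r r0; have [l lr] := m_adherent z' r0.
by have := m_le z l; have := D_le_e z z' l; lra.
Qed.

Let m_continuous : continuous m.
Proof.
move=> z; apply/cvgrPdist_lt => r r0.
have /cvgrPdist_lt/(_ r r0) := @e_continuous z z; apply: filterS => z'.
rewrite ezz sub0r normrN => /(le_lt_trans (ler_norm _)) ez.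
rewrite ltr_norml; have := m_le_e z z'; have := m_le_e z' z.
by rewrite (e_sym z' z); lra.
Qed.

(** The condition [m z = 0] stands under the quantifier so that [p] can be chosen for every [z]. *)
Let zero_exists z : exists p, m z = 0 -> D z p = 0.
Proof.
have [||p _ pmin] := @compact_EVT_min L R (D z) setT _ cL.
- by exists l0.
- exact: continuous_subspaceT (@D_continuous z).
exists p => mz; apply/eqP; rewrite eq_le D_ge0 andbT -mz.
by apply: lb_le_inf; [case: (hasD z)|move=> _ [l _ <-]; apply: pmin;
  exact: mem_set].
Qed.

Let p z := projT1 (cid (zero_exists z)).

Let pP z : m z = 0 -> D z (p z) = 0.
Proof. exact: projT2 (cid (zero_exists z)). Qed.

(** Weight is given only to the [x n] at which [D z] is less than twice its infimum. *)
Let w z n : R := Num.max 0 (2 * m z - D z (x n)).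

Let D_le z l : D z l <= 2 * (C + C).
Proof. exact: wsum_le2 (@uC z l). Qed.

Let w_ge0 z n : 0 <= w z n. Proof. by rewrite le_max lexx. Qed.

Let wC z : bounded_by (4 * (C + C)) (w z).
Proof.
move=> n; rewrite ger0_norm// ge_max; have := D_le z l0; have := D_ge0 z l0.
by have := m_le z l0; have := D_ge0 z (x n); lra.
Qed.

Let w_continuous n : continuous (w^~ n).
Proof.
move=> z; apply: (@continuous_max R K (fun=> 0)); first exact: cvg_cst.
apply: cvgB; last exact: D_continuousl.
by apply: cvgM; [exact: cvg_cst|exact: m_continuous].
Qed.

Let wfC f z : bounded_by (4 * (C + C) * `|f|) (fun n => w z n * f (x n)).
Proof.
by move=> n; rewrite normrM ler_pM//; [exact: wC|exact: le_Cspace_norm].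
Qed.

Let den z := wsum (w z).
Let num f z := wsum (fun n => w z n * f (x n)).

Let den_gt0 z : 0 < m z -> 0 < den z.
Proof.
move=> mz; have mz4 : 0 < m z / 4 by rewrite divr_gt0.
(* [D z l] is below [m z + m z / 2], and moving from [l] to an [x n] within [m z / 4] adds less than
   [m z / 2]. *)
have [l lm] := m_adherent z (divr_gt0 mz (ltr0Sn R 1)).
have [n nl] := xP l mz4.
have wn : 0 < w z n.
  by rewrite lt_max; apply/orP; right; have := D_le_dist z (x n) l; lra.
apply: lt_le_trans (wsum_ge_term n (@wC z) (w_ge0 z)).
by rewrite mulr_gt0// exprn_gt0// invr_gt0.
Qed.

Definition average f z := if 0 < m z then num f z / den z else f (p z).

(** The average is a weighted mean of values of [f] at points with [D z l <= 2 m z]. With [c = 0]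
    this bounds the norm; with [c] a value of [f] it gives continuity where [m] vanishes. *)
Let average_dist f z c r : (forall l, D z l <= 2 * m z -> `|f l - c| <= r) ->
  `|average f z - c| <= r.
Proof.
move=> fc; rewrite /average; case: ifPn => mz; last first.
  have {}mz : m z = 0 by apply/eqP; rewrite eq_le m_ge0 andbT leNgt.
  by apply: fc; rewrite pP// mz mulr0.
have d0 := den_gt0 mz.
have -> : num f z / den z - c = (num f z + (- c) * den z) / den z.
  by rewrite mulrDl !mulNr mulfK ?gt_eqF.
rewrite normrM normfV (gtr0_norm d0) ler_pdivrMr//.
rewrite /num /den -(wsumZ _ (@wC z)).
have cw : bounded_by (`|c| * (4 * (C + C))) (fun n => - c * w z n).
  by move=> n; rewrite normrM normrN ler_wpM2l//; exact: wC.
rewrite -(wsumD (@wfC f z) cw).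
have bb : bounded_by (4 * (C + C) * `|f| + `|c| * (4 * (C + C)))
    (fun n => w z n * f (x n) + - c * w z n).
  move=> n; apply: le_trans (ler_normD _ _) _.
  by apply: lerD; [exact: wfC|exact: cw].
have rw : bounded_by (`|r| * (4 * (C + C))) (fun n => r * w z n).
  by move=> n; rewrite normrM ler_wpM2l//; exact: wC.
apply: le_trans (wsum_norm bb) _; rewrite -(wsumZ _ (@wC z)).
apply: (wsum_le (C := 4 * (C + C) * `|f| + `|c| * (4 * (C + C))) _ rw) => n.
  by rewrite normr_id; exact: bb.
have -> : w z n * f (x n) + - c * w z n = w z n * (f (x n) - c) by ring.
rewrite normrM (ger0_norm (w_ge0 z n)) [leRHS]mulrC.
have [wn|wn] := leP (2 * m z - D z (x n)) 0; first by rewrite /w max_l// !mul0r.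
by rewrite ler_wpM2l//; apply: fc; lra.
Qed.

Let average_continuous f : continuous (average f).
Proof.
move=> z0; apply/cvgrPdist_lt => r r0.
have [mz|mz] := ltP 0 (m z0).
  have cq : {for z0, continuous (fun z => num f z / den z)}.
    apply: cvgM.
      apply: (@wsum_continuous R K (4 * (C + C) * `|f|)
        (fun z n => w z n * f (x n))) => [n z|z]; last exact: wfC.
      by apply: cvgM; [exact: w_continuous|exact: cvg_cst].
    apply: cvgV; first by rewrite gt_eqF// den_gt0.
    exact: (@wsum_continuous R K (4 * (C + C)) w).
  have nm : \forall z \near z0, 0 < m z by exact: (cvgr_gt _ (@m_continuous
    z0)).
  have /cvgrPdist_lt/(_ r r0) := cq; apply: filterS2 nm => z mz'.
  by rewrite /average mz mz'.
have {}mz : m z0 = 0 by apply/eqP; rewrite eq_le m_ge0 andbT.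
have -> : average f z0 = f (p z0) by rewrite /average mz ltxx.
have r2 : 0 < r / 2 by rewrite divr_gt0.
have /cvgrPdist_lt/(_ _ r2)/nbhs_ballP[rho /= rho0 fb] := @Cspace_cts _ _ _ _ f
  (p z0).
(* [eta] is the minimum of [D z0] over the compact set of points at distance at least [rho] from
   [p z0]; it is positive because [p z0] is the only zero. *)
have [eta eta0 etaP] : exists2 eta, 0 < eta &
    forall l, D z0 l < eta -> mdist (p z0) l < rho.
  have clA : closed [set l | rho <= mdist (p z0) l].
    apply: (@preimage_closed _ _ (mdist (p z0)) [set t | rho <= t]).
      by move=> l _; exact: continuous_mdist.
    exact: closed_ge.
  have [A0|A0] := pselect ([set l | rho <= mdist (p z0) l] !=set0); last first.
    exists 1 => // l _; rewrite ltNge; apply/negP => ll; apply: A0; by exists l.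
  have [l1 /set_mem/= l1A l1min] := compact_EVT_min A0
    (subclosed_compact clA cL (@subsetT _ _)) (continuous_subspaceT
      (@D_continuous z0)).
  exists (D z0 l1).
    rewrite lt_neqAle D_ge0 andbT eq_sym; apply/eqP => Dl1.
    by move: l1A; rewrite -(D_inj (pP mz) Dl1) mdistxx leNgt rho0.
  move=> l; apply: contraTT; rewrite -!leNgt => ll; apply: l1min;
    exact: mem_set.
(* If [e z0 z < eta / 4], then [m z < eta / 4], and [D z l <= 2 m z] gives [D z0 l < 3 eta / 4]. *)
have e4 : 0 < eta / 4 by rewrite divr_gt0.
have /cvgrPdist_lt/(_ _ e4) := @e_continuous z0 z0; apply: filterS => z.
rewrite ezz sub0r normrN => /(le_lt_trans (ler_norm _)) ez.
rewrite distrC; apply: (@le_lt_trans _ _ (r / 2)); last by lra.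
apply: average_dist => l Dl; rewrite distrC; apply/ltW/fb.
rewrite ballEmdist /=; apply: etaP.
have := D_le_e z0 z l; have := m_le_e z z0; rewrite mz (e_sym z z0); lra.
Qed.

Let average_linear (a : R) f g z :
  average (a *: f + g) z = a * average f z + average g z.
Proof.
rewrite /average; case: ifPn => // mz.
have -> : num (a *: f + g) z = a * num f z + num g z.
  have afC : bounded_by (`|a| * (4 * (C + C) * `|f|)) (fun n =>
    a * (w z n * f (x n))).
    by move=> n; rewrite normrM ler_wpM2l//; exact: wfC.
  rewrite /num -(wsumZ _ (@wfC f z)) -(wsumD afC (@wfC g z)).
  congr wsum; apply/funext => n.
  by rewrite CspaceDE CspaceZE mulrDr /GRing.scale /= mulrCA.
by rewrite mulrDl mulrA.
Qed.

Lemma positive_isometric_copy_of_averages : positive_isometric_copy (R := R) cL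
  cK.
Proof.
pose T f : Cspace cK R := cfun (@average_continuous f).
have linT : linear T.
  by move=> a f g; apply: Cspace_eq => z; exact: average_linear.
pose TL : {linear Cspace cL R -> Cspace cK R} :=
  HB.pack T (GRing.isLinear.Build _ _ _ _ T linT).
exists TL; split=> [f|f f0 z].
  apply/eqP; rewrite eq_le; apply/andP; split.
    apply: Cspace_norm_le => // z; rewrite -[_ z]subr0.
    by apply: average_dist => l _; rewrite subr0; exact: le_Cspace_norm.
  apply: Cspace_norm_le => // l.
  have [z Fz zl] : (phi @` F) l by rewrite sphi.
  have mz : m z = 0.
    by apply/eqP; rewrite eq_le m_ge0 andbT -(D_phi Fz) m_le.
  (* Over [F] the only zero of [D z] is [phi z], so [p z = phi z] and the average extends
     [f \o phi]. *)
  have <- : TL f z = f l.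
    have -> : TL f z = average f z by [].
    by rewrite /average mz ltxx -zl (D_inj (pP mz) (D_phi Fz)).
  exact: le_Cspace_norm.
have -> : TL f z = average f z by [].
rewrite /average; case: ifPn => // mz; apply: divr_ge0.
  by apply: (wsum_ge0 (@wfC f z)) => n; rewrite mulr_ge0.
exact: (wsum_ge0 (@wC z)).
Qed.

End Averages.

Lemma positive_isometric_copy_of_surjection : positive_isometric_copy (R := R)
  cL cK.
Proof.
have [C [x [G [xP dC cG GC GF]]]] := dist_extension.
exact: positive_isometric_copy_of_averages GF.
Qed.

End ExtensionOperator.

(** * Embeddings of distortion less than 3 *)

Section Bumps.
Context {R : realType} {L : metricType R} (cL : compact [set: L]).

(** The bump is 1 within [e / 2] of [y], 0 beyond [e], and affine in the distance in between. *)
Lemma bump_exists (y : L) (V : set L) : nbhs y V -> exists h : Cspace cL R,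
  [/\ forall x, 0 <= h x <= 1, forall x, ~ V x -> h x = 0 &
      exists2 V', nbhs y V' & forall x, V' x -> h x = 1].
Proof.
move=> /nbhs_ballP[e /= e0 eV].
have ch : continuous (fun x : L =>
  Num.min 1 (Num.max 0 (2 - 2 / e * mdist y x)) : R).
  move=> x; apply: (@continuous_min R L (fun=> 1)); first exact: cvg_cst.
  apply: (@continuous_max R L (fun=> 0)); first exact: cvg_cst.
  apply: cvgB; first exact: cvg_cst.
  by apply: cvgM; [exact: cvg_cst|exact: continuous_mdist].
pose h : Cspace cL R := cfun ch; exists h.
have hE x : h x = Num.min 1 (Num.max 0 (2 - 2 / e * mdist y x)) by [].
split=> [x|x nVx|].
- by rewrite hE le_min ler01 le_max lexx/= ge_min lexx.
- rewrite hE [Num.max _ _]max_l ?min_r//.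
  have : e <= mdist y x.
    by rewrite leNgt; apply: contra_notN nVx => yx; apply: eV;
      rewrite ballEmdist.
  by move=> ed; rewrite subr_le0 mulrAC ler_pdivlMr// ler_pM2l.
- exists (ball y (e / 2)); first by apply: nbhsx_ballx; rewrite divr_gt0.
  move=> x; rewrite ballEmdist /= => yx.
  have d1 : 1 <= 2 - 2 / e * mdist y x.
    rewrite lerBrDr -lerBrDl mulrAC ler_pdivrMr//.
    by move: yx; lra.
  by rewrite hE max_r ?min_l//; lra.
Qed.

Lemma disjoint_sum_at (I : finType) (a : I -> R) (h : I -> Cspace cL R)
    (V : I -> set L) i x : (forall i j u, V i u -> V j u -> i = j) ->
  (forall i u, ~ V i u -> h i u = 0) -> V i x ->
  (\sum_j a j *: h j) x = a i * h i x.
Proof.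
move=> dV h0 Vi; rewrite Cspace_sumE (bigD1 i)//= big1 ?addr0// => j ji.
rewrite CspaceZE h0 ?scaler0// => Vj; move/eqP: ji; apply.
exact: dV Vj Vi.
Qed.

Lemma disjoint_sum_le1 (I : finType) (a : I -> R) (h : I -> Cspace cL R)
    (V : I -> set L) x : (forall i j u, V i u -> V j u -> i = j) ->
  (forall i u, ~ V i u -> h i u = 0) -> (forall i u, 0 <= h i u <= 1) ->
  (forall i, `|a i| <= 1) -> `|(\sum_j a j *: h j) x| <= 1.
Proof.
move=> dV h0 h1 a1; have [[i Vi]|nV] := pselect (exists i, V i x).
  rewrite (disjoint_sum_at a dV h0 Vi) normrM -[leRHS]mulr1 ler_pM//.
  by have /andP[h0' h1'] := h1 i x; rewrite ger0_norm.
rewrite Cspace_sumE big1 ?normr0 ?ler01// => i _.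
by rewrite CspaceZE h0 ?scaler0// => Vi; apply: nV; exists i.
Qed.

End Bumps.

Lemma limit_point_infinite (S : topologicalType) (A U : set S) x :
  hausdorff_space S -> limit_point A x -> nbhs x U -> infinite_set (A `&` U).
Proof.
move=> hS lx xU fin.
have clF : closed ((A `&` U) `\ x).
  move/accessible_finite_set_closed : (hausdorff_accessible hS); apply.
  exact: finite_setD.
have [|y [yx Ay [Uy ny]]] := lx (U `&` ~` ((A `&` U) `\ x)).
  apply: filterI => //; apply: open_nbhs_nbhs; split; first exact: closed_openC.
  by move=> [_]; apply.
by apply: ny; split=> //; exact/eqP.
Qed.

Lemma scattered_of_cb_deriv (S : topologicalType) a :
  cb_deriv S a = set0 -> scattered S.
Proof.
move=> a0; exists a => b ab; apply/seteqP; split=> // x bx.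
by have := cb_deriv_anti ab bx; rewrite a0.
Qed.

(** * Transfer of derivatives along an embedding *)

Section SmallDistortion.
Context {R : realType} {L : metricType R} {K : topologicalType}.
Variables (cL : compact [set: L]) (cK : compact [set: K]).
Hypothesis hK : hausdorff_space K.
Hypothesis K0 : [set: K] !=set0.
Variable T : {linear Cspace cL R -> Cspace cK R}.
Variables (a M : R).
Hypothesis aM : M < 3 * a.
Hypothesis a0 : 0 < a.
Hypothesis M0 : 0 <= M.
Hypothesis T_upper : forall f, `|T f| <= M * `|f|.
Hypothesis T_lower : forall f, a * `|f| <= `|T f|.
Implicit Types (g h f : Cspace cL R) (V : set L) (y : L) (b : Ord).

Let hL : hausdorff_space L := @metric_hausdorff R L.

(** Of [3 a], at most [M] is due to the unit ball function [g + 2 f - 2 h]; the rest is due to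
    [2 h]. *)
Let delta : R := (3 * a - M) / 2.

Let delta_gt0 : 0 < delta.
Proof. by rewrite divr_gt0// subr_gt0. Qed.

Let T_le f k : (forall x, `|f x| <= 1) -> `|T f k| <= M.
Proof.
move=> f1; apply: le_trans (le_Cspace_norm (T f) k) _.
apply: le_trans (T_upper f) _; rewrite -[leRHS]mulr1 ler_wpM2l//.
exact: Cspace_norm_le.
Qed.

(* The conditions on [h] say that [g + 2 f - 2 h] is in the unit ball for all
   [f : L -> [0, 1]] that vanish outside [V]; so [big V g] contains every [k]
   such that [|T (g + 2 f) k| >= 3 a] for one such [f]. *)
Let big V g := [set k | forall h, (forall x, `|g x - 2 * h x| <= 1) ->
  (forall x, V x -> `|g x + 2 - 2 * h x| <= 1) -> delta <= `|T h k|].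

(** A larger [V] puts more conditions on [h], so fewer [h] are tested. *)
Let bigS V V' g : V `<=` V' -> big V g `<=` big V' g.
Proof. by move=> VV' k kV h gh gV; apply: kV => // x /VV'; exact: gV. Qed.

Let big_closed V g : closed (big V g).
Proof.
rewrite (_ : big V g = \bigcap_(h in [set h : Cspace cL R |
    (forall x, `|g x - 2 * h x| <= 1) /\
    (forall x, V x -> `|g x + 2 - 2 * h x| <= 1)]) [set k | delta <= `|T h k|]).
  apply: closed_bigI => h _.
  apply: (@preimage_closed _ _ (fun k => `|T h k|) [set x | delta <= x]).
    by move=> k _; apply: cvg_norm; exact: (@Cspace_cts).
  exact: closed_ge.
apply/seteqP; split=> k kV h; first by move=> [gh gV]; exact: kV.
by move=> gh gV; apply: (kV h).
Qed.

Let big_nonempty V g y : nbhs y V -> g y = 1 -> big V g !=set0.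
Proof.
move=> yV gy; have [f [f01 f0 [V' yV' f1]]] := bump_exists cL yV.
have fy : f y = 1 by apply: f1; exact: nbhs_singleton.
have [k kE] := Cspace_norm_attained (T (g + 2 *: f)) K0.
have k3 : 3 * a <= `|T (g + 2 *: f) k|.
  rewrite kE; apply: le_trans (T_lower _); rewrite mulrC ler_pM2l//.
  have := le_Cspace_norm (g + 2 *: f) y; rewrite CspaceDE CspaceZE fy gy.
  by apply: le_trans; rewrite ger0_norm; rewrite /GRing.scale/=; lra.
exists k => h gh gV.
have : `|T (g + 2 *: f - 2 *: h) k| <= M.
  apply: T_le => x; rewrite !(CspaceDE, CspaceNE, CspaceZE) /GRing.scale/=.
  have [Vx|nVx] := pselect (V x); last by rewrite f0// mulr0 addr0; exact: gh.
  (* The value is the mean of [g x - 2 h x] and [g x + 2 - 2 h x] with weights [1 - f x] and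
     [f x]. *)
  have /andP[fx0 fx1] := f01 x; have := gh x; have := gV x Vx.
  by rewrite !ler_norml => /andP[? ?] /andP[? ?]; apply/andP; split; nra.
rewrite linearB linearZ CspaceDE CspaceNE CspaceZE.
have := lerB_dist (T (g + 2 *: f) k) (2 *: T h k).
rewrite normrZ ger0_norm// => ? ?; rewrite /delta ler_pdivrMr//.
by lra.
Qed.

(** [T] is applied to the sum of the bumps with the signs of [T (h i) k], which is in the unit ball
    by disjointness. *)
Let sum_bumps_le (I : finType) (h : I -> Cspace cL R) (V : I -> set L) k :
  (forall i j u, V i u -> V j u -> i = j) ->
  (forall i u, ~ V i u -> h i u = 0) -> (forall i u, 0 <= h i u <= 1) ->
  \sum_i `|T (h i) k| <= M.
Proof.
move=> dV h0 h1.
have -> : \sum_i `|T (h i) k| = T (\sum_i Num.sg (T (h i) k) *: h i) k.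
  rewrite linear_sum Cspace_sumE; apply: eq_bigr => i _.
  by rewrite linearZ CspaceZE normrEsg.
apply: le_trans (ler_norm _) _; apply: T_le => x.
apply: disjoint_sum_le1 dV h0 h1 _ => i; rewrite normr_sg.
by case: (_ != 0).
Qed.

(** If the successor case fails, [big V g] meets K^(b) in a finite set [X]. By induction, for each
    of many disjoint bumps at points of L^(b) in [V], the image under [T] is at least [delta] in
    absolute value at some point of [X]. But by [sum_bumps_le] each point of [X] allows a total of
    at most [M]. *)
Lemma big_cb_deriv b y V g : cb_deriv L b y -> nbhs y V ->
  (forall x, `|g x| <= 1) -> (forall x, V x -> g x = 1) ->
  big V g `&` cb_deriv K b !=set0.
Proof.
move=> + + g1; elim: b y V => [|b IHb|J F IHF] y V; last first.
- move=> Fy yV gV; apply: cb_deriv_sup => //.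
  + by apply: (big_nonempty yV); apply: gV; exact: nbhs_singleton.
  + by move=> i; apply: (IHF i y) => //; exact: Fy.
- move=> [by_ ly] yV gV; apply: contrapT => H.
  have fin : finite_set (big V g `&` cb_deriv K b).
    apply: finite_no_derived => //.
      by apply: closedI => //; exact: cb_deriv_closed.
    apply/seteqP; split=> // k [[Vk bk] lk]; apply: H; exists k; split=> //.
    by split=> // U kU; have [k' [? [] ? ? ?]] := lk U kU; exists k'.
  have [X XE] := finite_fsetP.1 fin.
  (* The size of [B] is chosen such that [|B| delta > |X| M]. *)
  have [B BL NB] := infinite_set_fset (Num.trunc (#|` X|%:R * M / delta)).+1
    (limit_point_infinite hL ly (nbhs_interior yV)).
  have [W [nW dW]] := separate_finite hL (@val_inj _ _ B).
  have BP (i : B) : cb_deriv L b (val i) /\ V° (val i) by apply: BL;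
    exact: valP.
  have bumpP (i : B) : exists hV : Cspace cL R * set L,
      [/\ nbhs (val i) hV.2, forall x, 0 <= hV.1 x <= 1,
          forall x, ~ (W i `&` V) x -> hV.1 x = 0 & forall x, hV.2 x -> hV.1 x
            = 1].
    have [|h [h1 h0 [V' yV' hV']]] := @bump_exists _ _ cL (val i) (W i `&` V°).
      by apply: filterI => //; exact: nbhs_interior (BP i).2.
    exists (h, V'); split=> // x nWV; apply: h0 => -[Wx Vx]; apply: nWV.
    by split=> //; exact: interior_subset.
  have [hV hVP] := choice bumpP.
  have VS i : (hV i).2 `<=` W i `&` V.
    have [_ _ h0 h1] := hVP i; move=> x Vx; apply: contrapT => /h0 /eqP.
    by rewrite h1// oner_eq0.
  have kP (i : B) : exists k, (big V g `&` cb_deriv K b) k /\ delta <= `|T (hV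
    i).1 k|.
    have [nV h01 h0 h1] := hVP i.
    have [|k [bk dk]] := IHb (val i) (hV i).2 (BP i).1 nV.
      by move=> x /VS[_]; exact: gV.
    exists k; split; first by split=> //; apply: bigS bk => x /VS[].
    (* The bump is an admissible [h]: on [V], where [g] is 1, it has values in [0, 1], outside [V]
       it vanishes, and where it is 1 the function [g + 2 - 2 h] is 1. *)
    apply: bk => x => [|Vx]; last first.
      have [_ gx] := VS _ _ Vx; rewrite h1// gV//.
      by rewrite ler_norml; lra.
    have [Vx|nVx] := pselect (V x).
      by rewrite gV// ler_norml; have := h01 x; lra.
    by rewrite h0 ?mulr0 ?subr0// => -[].
  have [kk kkP] := choice kP.
  have kX (i : B) : kk i \in X by have [] := kkP i; rewrite XE.
  have : \sum_(i : B) delta <= \sum_(x : X) M.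
    apply: (@le_trans _ _ (\sum_(x : X) \sum_(i : B) `|T (hV i).1 (val x)|)).
      rewrite exchange_big/=; apply: ler_sum => i _.
      rewrite (bigD1 (FSetSub (kX i)))//= ler_wpDr ?sumr_ge0//.
      by case: (kkP i).
    apply: ler_sum => x _; apply: (sum_bumps_le (h := fun i =>
      (hV i).1) (V := W)) => //.
      by move=> i u nW'; have [_ _ h0 _] := hVP i; apply: h0 => -[].
    by move=> i u; case: (hVP i).
  rewrite !sumr_const -!cardfE -[delta *+ _]mulr_natr -[M *+ _]mulr_natr.
  have : #|` X|%:R * M / delta < #|` B|%:R :> R.
    by apply: lt_le_trans (truncnS_gt _) _; rewrite ler_nat.
  by rewrite ltr_pdivrMr//; lra.
- by move=> _ yV gV; rewrite setIT; apply: (big_nonempty yV); apply: gV;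
    exact: nbhs_singleton.
Qed.

Lemma small_distortion_nonscattered : ~ scattered L -> ~ scattered K.
Proof.
move=> nL [b bK]; apply: nL; apply: (@scattered_of_cb_deriv _ b).
apply/seteqP; split=> // y yb.
have [|||k [_]] := @big_cb_deriv b y setT (Ccst cL (1 : R)) yb.
- exact: filterT.
- by move=> x; rewrite /= normr1.
- by [].
by rewrite (bK b (ole_refl b)).
Qed.

(** If K^(b) had fewer points than L^(b), some nontrivial combination [g] of disjoint bumps at the
    points of L^(b) would have [T g = 0] on K^(b). Scaled to norm at most 1 and value 1 near one of
    the points, [g] contradicts [big_cb_deriv]. *)
Lemma small_distortion_card b : finite_set (cb_deriv L b) ->
  (cb_deriv L b #<= cb_deriv K b)%card.
Proof.
move=> finL; have [finK|/infiniteP infK] := pselect (finite_set (cb_deriv K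
  b)); last first.
  by apply: card_le_trans infK; exact: finite_set_countable.
have [X XE] := finite_fsetP.1 finL; have [Y YE] := finite_fsetP.1 finK.
have cX : ([set` X] #= `I_(#|` X|))%card by apply/card_eq_fsetP.
have cY : ([set` Y] #= `I_(#|` Y|))%card by apply/card_eq_fsetP.
rewrite XE YE (card_le_eql cX) (card_le_eqr cY) card_le_II leqNgt;
  apply/negP => YX.
have [W [nW dW]] := separate_finite hL (@val_inj _ _ X).
have bX (i : X) : cb_deriv L b (val i) by rewrite XE; exact: valP.
have bumpP (i : X) : exists hV : Cspace cL R * set L,
    [/\ nbhs (val i) hV.2, forall x, 0 <= hV.1 x <= 1,
        forall x, ~ W i x -> hV.1 x = 0 & forall x, hV.2 x -> hV.1 x = 1].
  have [h [h1 h0 [V' yV' hV']]] := bump_exists cL (nW i).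
  by exists (h, V').
have [hV hVP] := choice bumpP.
pose A : 'M[R]_(#|{: X}|, #|{: Y}|) :=
  \matrix_(i, j) T (hV (enum_val i)).1 (val (enum_val j)).
(* The matrix has more rows (points of L^(b)) than columns (points of K^(b)), so its left kernel is
   nonzero. *)
have [v v0 vA] : exists2 v : 'rV[R]_#|{: X}|, v != 0 & v *m A = 0.
  have : kermx A != 0.
    rewrite kermx_eq0 /row_free; apply: contraTN YX => /eqP rA.
    by rewrite -leqNgt !cardfE -rA rank_leq_col.
  move=> /rowV0Pn[v vk v0]; exists v => //; exact/sub_kermxP.
have [i0 i0max] : exists i0, forall i, `|v 0 i| <= `|v 0 i0|.
  have [i1 _] : exists i, v 0 i != 0.
    by have /rV0Pn := v0.
  exists [arg max_(i > i1) `|v 0 i|]%O.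
  by case: arg_maxP => //= i0 _ i0max i; exact: i0max.
have vi0 : v 0 i0 != 0.
  apply: contra_neq v0 => vi0; apply/rowP => i; rewrite mxE.
  by apply/eqP; rewrite -normr_le0; apply: le_trans (i0max i) _;
    rewrite vi0 normr0.
(* Division by a coefficient of largest absolute value bounds all coefficients by 1 and makes the
   one at [i0] equal to 1. *)
pose w (i : X) := v 0 (enum_rank i) / v 0 i0.
have w1 i : `|w i| <= 1.
  by rewrite normrM normfV ler_pdivrMr ?normr_gt0// mul1r.
pose g := \sum_i w i *: (hV i).1.
have h01 i x : 0 <= (hV i).1 x <= 1 by case: (hVP i).
have h0 i x : ~ W i x -> (hV i).1 x = 0 by case: (hVP i) => _ _ + _; apply.
pose y0 := enum_val i0.
have [nV _ _ h1] := hVP y0.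
have [||k [bk dk]] := @big_cb_deriv b _ (hV y0).2 g (bX y0) nV.
- by move=> x; exact: disjoint_sum_le1 dW h0 h01 w1.
- move=> x Vx; have Wx : W y0 x.
    by apply: contrapT => /h0/eqP; rewrite h1// oner_eq0.
  by rewrite (disjoint_sum_at w dW h0 Wx) h1// mulr1 /w enum_valK divff.
have kY : k \in Y by move: dk; rewrite YE.
suff Tg0 : T g k = 0.
  (* The test function [h = g] is admissible: [g - 2 g = - g], and [g + 2 - 2 g = 1] on the
     neighbourhood of [y0]. *)
  have := bk g; rewrite Tg0 normr0 leNgt delta_gt0 => H; apply/notF/H => x.
    rewrite (_ : _ - _ = - g x); last by lra.
    by rewrite normrN; exact: disjoint_sum_le1 dW h0 h01 w1.
  move=> Vx; have Wx : W y0 x.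
    by apply: contrapT => /h0/eqP; rewrite h1// oner_eq0.
  rewrite (disjoint_sum_at w dW h0 Wx) h1// mulr1 /w enum_valK divff//.
  by rewrite ler_norml; lra.
rewrite linear_sum Cspace_sumE.
have /rowP/(_ (enum_rank (FSetSub kY))) := vA; rewrite !mxE => vA0.
transitivity ((\sum_i v 0 i * A i (enum_rank (FSetSub kY))) / v 0 i0);
  last first.
  by rewrite vA0 mul0r.
rewrite mulr_suml (reindex_onto enum_rank enum_val); last by move=> i _;
  exact: enum_valK.
apply: eq_big => [i|i _]; first by rewrite enum_rankK eqxx.
rewrite linearZ CspaceZE mxE !enum_rankK /w /GRing.scale /=.
by rewrite mulrAC.
Qed.

End SmallDistortion.

(** * The equivalences *)

Section OperatorNorm.
Context {R : realType} {X Y : normedModType R}.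
Implicit Types (D : set X) (T : X -> Y).

Lemma le_operator_norm D T x : bounded_operator D T -> D x -> `|x| <= 1 ->
  `|T x| <= operator_norm D T.
Proof.
move=> [M TM] Dx x1; apply: ub_le_sup; last by exists x.
exists `|M| => _ [y [Dy y1] <-]; apply: le_trans (TM y Dy) _.
apply: le_trans (ler_norm _) _; rewrite normrM normr_id.
by rewrite -[leRHS]mulr1 ler_wpM2l.
Qed.

(** The degenerate cases hold because [sup] is 0 on empty and on unbounded sets. *)
Lemma operator_norm_ge0 D T : 0 <= operator_norm D T.
Proof.
have [D0|D0] := pselect ([set `|T x| | x in [set x | D x /\ `|x| <= 1]]
  !=set0); last first.
  by rewrite /operator_norm; move/nonemptyPn : D0 => ->; rewrite sup0.
have [ubD|nub] := pselect (has_ubound [set `|T x| | x in [set x | D x /\ `|x|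
  <= 1]]).
  by have [y yD] := D0; apply: le_trans (ub_le_sup ubD yD); case: yD => x _ <-.
by rewrite /operator_norm sup_out// => -[].
Qed.

Lemma operator_norm_le D T M : 0 <= M ->
  (forall x, D x -> `|x| <= 1 -> `|T x| <= M) -> operator_norm D T <= M.
Proof.
move=> M0 TM.
have [D0|D0] := pselect ([set `|T x| | x in [set x | D x /\ `|x| <= 1]] !=set0).
  by apply: ge_sup => // _ [x [Dx x1] <-]; exact: TM.
by rewrite /operator_norm; move/nonemptyPn : D0 => ->; rewrite sup0.
Qed.

End OperatorNorm.

Section OperatorNormLinear.
Context {R : realType} {X Y : normedModType R}.

Lemma operator_norm_upper (T : {linear X -> Y}) x :
  bounded_operator [set: X] T -> `|T x| <= operator_norm [set: X] T * `|x|.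
Proof.
move=> bT; have [->|x0] := eqVneq x 0; first by rewrite linear0 !normr0 mulr0.
have nx : 0 < `|x| by rewrite normr_gt0.
have := @le_operator_norm _ _ _ setT T (`|x|^-1 *: x) bT I.
rewrite linearZ !normrZ !normfV !normr_id mulVf ?gt_eqF// => /(_ (lexx _)).
by rewrite mulrC ler_pdivrMr.
Qed.

(** [Tinv] is a mere function; its homogeneity on the range comes from [cancel T Tinv]. *)
Lemma operator_norm_lower (T : {linear X -> Y}) (Tinv : Y -> X) x :
  isomorphic_embedding T Tinv -> `|x| <= operator_norm (range T) Tinv * `|T x|.
Proof.
move=> [TK _ bTi]; have [->|x0] := eqVneq x 0;
  first by rewrite linear0 !normr0 mulr0.
have Tx0 : T x != 0.
  by apply: contra_neq x0 => Tx0; rewrite -(TK x) Tx0 -(linear0 T) TK.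
have nx : 0 < `|T x| by rewrite normr_gt0.
have := @le_operator_norm _ _ _ (range T) Tinv (`|T x|^-1 *: T x) bTi.
rewrite -linearZ TK linearZ !normrZ !normfV !normr_id mulVf ?gt_eqF// => H.
rewrite mulrC -ler_pdivrMl//; apply: H => //; by exists (`|T x|^-1 *: x);
  rewrite ?linearZ.
Qed.

End OperatorNormLinear.

Section Equivalences.
Context {R : realType} {L : metricType R} {K : topologicalType}.
Variables (cL : compact [set: L]) (cK : compact [set: K]).

Lemma isometric_embedding_distortion :
  isometric_copy (Cspace cL R) (Cspace cK R) ->
  exists (T : {linear Cspace cL R -> Cspace cK R})
        (Tinv : Cspace cK R -> Cspace cL R),
      isomorphic_embedding T Tinv /\
      operator_norm [set: Cspace cL R] T * operator_norm (range T) Tinv < 3.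
Proof.
move=> [T Tiso].
have Tinj : injective T.
  move=> f g fg; apply/eqP; rewrite -subr_eq0 -normr_eq0 -Tiso linearB fg subrr.
  by rewrite normr0.
have [Tinv TK] : exists Tinv : Cspace cK R -> Cspace cL R, cancel T Tinv.
  have inv (y : Cspace cK R) : exists x : Cspace cL R, forall x', T x' = y ->
    x' = x.
    have [[x xy]|n] := pselect (exists x, T x = y); last first.
      by exists 0 => x' x'y; case: n; exists x'.
    by exists x => x'; rewrite -xy => /Tinj.
  have [Tinv TinvP] := choice inv; exists Tinv => x; apply/esym.
  exact: TinvP.
exists T, Tinv; split.
  split=> //; first by exists 1 => f _; rewrite Tiso mul1r.
  by exists 1 => _ [f _ <-]; rewrite TK Tiso mul1r.
apply: (@le_lt_trans _ _ (1 * 1)); last by rewrite mul1r ltr1n.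
apply: ler_pM; [exact: operator_norm_ge0|exact: operator_norm_ge0| |].
  by apply: operator_norm_le => // f _; rewrite Tiso.
by apply: operator_norm_le => // _ [f _ <-]; rewrite TK Tiso.
Qed.

(** Multiplying [T f] by a fixed unit vector of [E] keeps the norm. *)
Lemma isometric_copy_tensor (E : normedModType R) : (exists e : E, e != 0) ->
  isometric_copy (Cspace cL R) (Cspace cK R) ->
  isometric_copy (Cspace cL R) (Cspace cK E).
Proof.
move=> [e0 e00] [T Tiso].
pose e := `|e0|^-1 *: e0.
have e1 : `|e| = 1 by rewrite normrZ normfV normr_id mulVf// normr_eq0.
have cTe (f : Cspace cL R) : continuous (fun x => T f x *: e).
  by move=> x; apply: cvgZr_tmp; exact: (@Cspace_cts).
pose S f : Cspace cK E := cfun (@cTe f).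
have linS : linear S.
  move=> a f g; apply: Cspace_eq => x.
  rewrite CspaceDE CspaceZE.
  have SE h : S h x = T h x *: e by [].
  by rewrite !SE linearP CspaceDE CspaceZE scalerDl scalerA.
pose SL : {linear Cspace cL R -> Cspace cK E} :=
  HB.pack S (GRing.isLinear.Build _ _ _ _ S linS).
exists SL => f; rewrite -Tiso.
have SE x : `|SL f x| = `|T f x| by rewrite /= normrZ e1 mulr1.
apply/eqP; rewrite eq_le; apply/andP; split; apply: Cspace_norm_le => // x.
  by rewrite SE; exact: le_Cspace_norm.
by rewrite -SE; exact: le_Cspace_norm.
Qed.

Lemma strictly_convex_real : strictly_convex R.
Proof.
move=> x y x1 y1 xy.
have /eqP := x1; have /eqP := y1; rewrite !eqr_norml !ler01 !andbT.
move=> /orP[]/eqP yE /orP[]/eqP xE; move: xy; rewrite xE yE ?eqxx// => _.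
  by rewrite addNr scaler0 normr0.
by rewrite subrr scaler0 normr0.
Qed.

Hypothesis L0 : [set: L] !=set0.
Hypothesis hK : hausdorff_space K.
Hypothesis K0 : [set: K] !=set0.

Let hL : hausdorff_space L := @metric_hausdorff R L.

Lemma closed_surjection_of_height_condition :
  (~ scattered L -> ~ scattered K) /\
    (scattered L -> exists b : Ord, is_height L (osucc b) /\
       (cb_deriv L b #<= cb_deriv K b)%card) ->
  exists (F : set K) (phi : K -> L),
    [/\ closed F, {within F, continuous phi} & phi @` F = [set: L]].
Proof.
move=> [nsK sK]; have [l0 _] := L0.
have [/sK[b [[Lb0 bmin] Lb]]|/nsK] := pselect (scattered L).
  apply: (closed_surjection_of_scattered cL cK hK l0 Lb0) => //.
  by apply/set0P/eqP => /bmin; exact: olt_irr.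
exact: closed_surjection_of_nonscattered.
Qed.

(** Choosing a point of K^(a) in each fibre over L^(a), by [cb_deriv_image], is injective as fibres
    are disjoint. *)
Lemma cb_deriv_card_le (F : set K) (phi : K -> L) a : closed F ->
  {within F, continuous phi} -> phi @` F = [set: L] ->
  (cb_deriv L a #<= cb_deriv K a)%card.
Proof.
move=> clF cphi sphi.
have lift y : exists z, cb_deriv L a y -> phi z = y /\ cb_deriv K a z.
  have [ay|nay] := pselect (cb_deriv L a y); last first.
    by have [k0 _] := K0; exists k0.
  by have [z [[_ zy] az]] := cb_deriv_image cK hK hL clF cphi sphi ay; exists z.
have [g gP] := choice lift.
have ginj : {in cb_deriv L a &, injective g}.
  move=> y y' /set_mem/gP[gy _] /set_mem/gP[gy' _] gg.
  by rewrite -gy -gy' gg.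
rewrite -(card_le_eql (inj_card_eq ginj)); apply: subset_card_le.
by move=> _ [y /gP[_ gy] <-].
Qed.

Lemma scattered_height : scattered L -> exists b,
  [/\ is_height L (osucc b), cb_deriv L b !=set0 & cb_deriv L (osucc b) = set0].
Proof.
move=> [a /(_ a (ole_refl a)) a0].
have [b [Sb0 b0]] := height_exists cL hL L0 a0.
by exists b; split=> //; exact: height_succ.
Qed.

Lemma height_condition_of_card :
  (forall a, (cb_deriv L a #<= cb_deriv K a)%card) ->
  (~ scattered L -> ~ scattered K) /\
    (scattered L -> exists b : Ord, is_height L (osucc b) /\
       (cb_deriv L b #<= cb_deriv K b)%card).
Proof.
move=> LK; split=> [nL [a /(_ a (ole_refl a)) aK]|/scattered_height[b [hb _
  _]]].
  apply: nL; apply: (@scattered_of_cb_deriv _ a); apply/eqP.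
  by have := LK a; rewrite aK card_le0.
by exists b.
Qed.

(** With [a = c^-1] the distortion bound becomes [M < 3 a]; here [c] is positive because the
    constant 1 has nonzero norm on the nonempty [L]. *)
Lemma height_condition_of_distortion (T : {linear Cspace cL R -> Cspace cK R})
    (Tinv : Cspace cK R -> Cspace cL R) : isomorphic_embedding T Tinv ->
  operator_norm [set: Cspace cL R] T * operator_norm (range T) Tinv < 3 ->
  (~ scattered L -> ~ scattered K) /\
    (scattered L -> exists b : Ord, is_height L (osucc b) /\
       (cb_deriv L b #<= cb_deriv K b)%card).
Proof.
move=> emb; set M := operator_norm _ T; set c := operator_norm _ _ => Mc.
have up f : `|T f| <= M * `|f| by apply: operator_norm_upper; case: emb.
have c0 : 0 < c.
  have one1 : 1 <= `|Ccst cL (1 : R)|.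
    have [l0 _] := L0; apply: le_trans (le_Cspace_norm (Ccst cL (1 : R)) l0).
    by rewrite /= normr1.
  rewrite lt_neqAle operator_norm_ge0 andbT; apply/eqP => cE.
  have := operator_norm_lower (Ccst cL (1 : R)) emb.
  by rewrite -/c -cE mul0r leNgt (lt_le_trans ltr01 one1).
have low f : c^-1 * `|f| <= `|T f|.
  by rewrite ler_pdivrMl//; exact: operator_norm_lower.
have Mc' : M < 3 * c^-1 by rewrite ltr_pdivlMr.
have ic0 : 0 < c^-1 by rewrite invr_gt0.
have M0 : 0 <= M by exact: operator_norm_ge0.
split; first exact: small_distortion_nonscattered Mc' ic0 M0 up low.
move=> /scattered_height[b [hb _ Sb0]]; exists b; split=> //.
apply: small_distortion_card Mc' ic0 M0 up low _ _ => //.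
by apply: finite_no_derived => //; exact: cb_deriv_closed.
Qed.

End Equivalences.

Unset Implicit Arguments.

Theorem theorem4p1 (R : realType) (L : metricType R) (K : topologicalType)
    (cL : compact [set: L]) (L0 : [set: L] !=set0)
    (cK : compact [set: K]) (hK : hausdorff_space K) (K0 : [set: K] !=set0) :
  [<->
    (* i *) isometric_copy (Cspace cL R) (Cspace cK R);
    (* ii *) exists (F : set K) (phi : K -> L),
      [/\ closed F, {within F, continuous phi} & phi @` F = [set: L]];
    (* iii *) forall a : Ord, (cb_deriv L a #<= cb_deriv K a)%card;
    (* iv *) (~ scattered L -> ~ scattered K) /\
      (scattered L -> exists b : Ord, is_height L (osucc b) /\
                        (cb_deriv L b #<= cb_deriv K b)%card);
    (* v *) positive_isometric_copy (R := R) cL cK;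
    (* vi *) exists (T : {linear Cspace cL R -> Cspace cK R})
        (Tinv : Cspace cK R -> Cspace cL R),
      isomorphic_embedding T Tinv /\
      operator_norm [set: Cspace cL R] T * operator_norm (range T) Tinv < 3;
    (* vii *) forall E : completeNormedModType R, (exists x : E, x != 0) ->
      isometric_copy (Cspace cL R) (Cspace cK E);
    (* viii *) exists E : completeNormedModType R,
      [/\ exists x : E, x != 0, strictly_convex E &
          isometric_copy (Cspace cL R) (Cspace cK E)]].
Proof.
have [l0 _] := L0.
have surj_pos : (exists (F : set K) (phi : K -> L),
      [/\ closed F, {within F, continuous phi} & phi @` F = [set: L]]) ->
    positive_isometric_copy (R := R) cL cK.
  move=> [F [phi [clF cphi sphi]]].
  exact: (positive_isometric_copy_of_surjection cL cK hK clF cphi sphi l0).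
have pos_iso : positive_isometric_copy (R := R) cL cK ->
    isometric_copy (Cspace cL R) (Cspace cK R).
  by move=> [T [Tiso _]]; exists T.
(* The implications form one cycle; wherever an isometry is to be produced from (iv), (vi) or
   (viii), the way leads through the surjection of (ii). *)
tfae.
- move=> [T Tiso].
  exact: (closed_surjection_of_isometry K0 (@strictly_convex_real R) Tiso l0).
- by move=> [F [phi [clF cphi sphi]]] a;
  exact: (cb_deriv_card_le cK hK K0 a clF cphi sphi).
- exact: height_condition_of_card.
- by move=> iv; apply: surj_pos;
  exact: (closed_surjection_of_height_condition cL cK L0 hK iv).
- by move=> /pos_iso; exact: isometric_embedding_distortion.
(* From (vi) to (iv), then to the surjection, a positive isometry and its product with a unit vector
   of [E]. *)
- move=> [T [Tinv [emb dist]]] E E0; apply: isometric_copy_tensor => //.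
  apply/pos_iso/surj_pos; apply: closed_surjection_of_height_condition => //.
  exact: height_condition_of_distortion emb dist.
- move=> vii; exists R; split.
  + by exists 1; exact: oner_neq0.
  + exact: strictly_convex_real.
  + by apply: vii; exists 1; exact: oner_neq0.
- move=> [E [_ convE [T Tiso]]]; apply/pos_iso/surj_pos.
  exact: (closed_surjection_of_isometry K0 convE Tiso l0).
Qed.
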